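(* For every $\mu\in\Sigma_{alg}(\mathcal B)$ and every linear map $\alpha:\mathcal B\to\mathcal B$ one has $$\bigl(\mathbb B_\alpha(\mu)\bigr)^{\uplus(1+\alpha)}=\mu^{\boxplus(1+\alpha)},$$ where $1$ denotes the identity map on $\mathcal B$. As a consequence, if $\alpha:\mathcal B\to\mathcal B$ is a linear map such that $1+\alpha$ is invertible, then $$\mathbb B_\alpha(\mu)=\bigl(\mu^{\boxplus(1+\alpha)}\bigr)^{\uplus((1+\alpha)^{-1})},\qquad \mu\in\Sigma_{alg}(\mathcal B).$$
   Context: $\mathcal B$ is a fixed unital $C^*$-algebra. Distributions. $\mathcal B\langle \mathcal X\rangle$ is the algebra of polynomials in a formal variable $\mathcal X$ with coefficients in $\mathcal B$, where $\mathcal X$ and $\mathcal B$ are algebraically independent: as a vector space it is $\bigoplus_{n\ge 0}$ of the spans of the monomials $b_0\mathcal X b_1\cdots \mathcal X b_n$, the $n$-th span being isomorphic to $\mathcal B^{\otimes_{\mathbb C}(n+1)}$. $\Sigma_{alg}(\mathcal B)$ is the set of all $\mathbb C$-linear $\mathcal B$-bimodule maps $\mu:\mathcal B\langle\mathcal X\rangle\to\mathcal B$ with $\mu[b]=b$ for $b\in\mathcal B$. Series. $\mathrm{Ser}(\mathcal B)$ is the set of sequences $F=(F^{[n]})_{n\ge1}$ with $F^{[1]}\in\mathcal B$ and $F^{[n]}:\mathcal B^{n-1}\to\mathcal B$ $\mathbb C$-multilinear. For linear $\alpha:\mathcal B\to\mathcal B$, $(\alpha\circ F)^{[n]}:=\alpha\circ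 F^{[n]}$. The moment series of $\mu\in\Sigma_{alg}(\mathcal B)$ is $M_\mu^{[1]}=\mu[\mathcal X]$, $M_\mu^{[n]}(b_1,\dots,b_{n-1})=\mu[\mathcal Xb_1\mathcal X\cdots b_{n-1}\mathcal X]$; $\mu\mapsto M_\mu$ is a bijection $\Sigma_{alg}(\mathcal B)\to\mathrm{Ser}(\mathcal B)$. Nested functionals. $NC(n)$ is the set of non-crossing partitions of $\{1,\dots,n\}$, and $\mathrm{Int}(n)\subseteq NC(n)$ the set of interval partitions (all blocks are intervals of consecutive integers). For $F\in\mathrm{Ser}(\mathcal B)$ and $\pi\in NC(n)$, the multilinear map $F^{[\pi]}:\mathcal B^{n-1}\to\mathcal B$ is obtained by reading the string $W_1b_1W_2b_2\cdots W_{n-1}b_{n-1}W_n$ as a parenthesized expression, where: if $m$ is the minimum of a block $V$ with $|V|=k\ge2$ then $W_m$ is ''$F^{[k]}($''; if $m$ is the maximum of a block with at least 2 elements then $W_m$ is ''$)$''; if $m\in V$ with $\min V<m<\max V$ then $W_m$ is a comma; if $\{m\}$ is a block then $W_m$ is ''$F^{[1]}$''. Example: for $\pi=\{\{1,4,5\},\{2,3\}\}$, $F^{[\pi]}(b_1,\dots,b_4)=F^{[3]}(b_1F^{[2]}(b_2)b_3,b_4)$. If $c:\pi\to\{1,2\}$ is a colouring of the blocks and $F,G\in\mathrm{Ser}(\mathcal B)$, then $(F,G)^{[\pi,c]}$ is defined by the same rule, except that blocks $V$ with $c(V)=1$ use the term $F^{[|V|]}$ and blocks with $c(V)=2$ use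 the term $G^{[|V|]}$. Transforms and convolution powers. For $\mu\in\Sigma_{alg}(\mathcal B)$, the $R$-transform $R_\mu$ and the $B$-transform $B_\mu$ are the unique series in $\mathrm{Ser}(\mathcal B)$ with $M_\mu^{[n]}=\sum_{\pi\in NC(n)}R_\mu^{[\pi]}$ and $M_\mu^{[n]}=\sum_{\pi\in\mathrm{Int}(n)}B_\mu^{[\pi]}$ for all $n\ge1$. Both $\mu\mapsto R_\mu$ and $\mu\mapsto B_\mu$ are bijections $\Sigma_{alg}(\mathcal B)\to\mathrm{Ser}(\mathcal B)$. For linear $\alpha:\mathcal B\to\mathcal B$, the distributions $\mu^{\boxplus\alpha},\mu^{\uplus\alpha}\in\Sigma_{alg}(\mathcal B)$ are determined by $R_{\mu^{\boxplus\alpha}}=\alpha\circ R_\mu$ and $B_{\mu^{\uplus\alpha}}=\alpha\circ B_\mu$. The maps $\widehat{\mathrm{RB}}_\alpha$ and $\mathbb B_\alpha$. For $\pi\in NC(n)$ write $\pi\ll 1_n$ if $1$ and $n$ lie in the same block of $\pi$; that block is denoted $V_o(\pi)$. Let $\mathrm o_\pi$ be the colouring of $\pi$ with $\mathrm o_\pi(V_o(\pi))=1$ and $\mathrm o_\pi(V)=2$ for all other blocks. For linear $\alpha:\mathcal B\to\mathcal B$, $\widehat{\mathrm{RB}}_\alpha:\mathrm{Ser}(\mathcal B)\to\mathrm{Ser}(\mathcal B)$ is given by $\widehat{\mathrm{RB}}_\alpha(F)^{[n]}=\sum_{\pi\in NC(n),\,\pi\ll1_n}(F,\alpha\circ F)^{[\pi,\mathrm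 o_\pi]}$, $n\ge1$. For $\mu\in\Sigma_{alg}(\mathcal B)$, $\mathbb B_\alpha(\mu)\in\Sigma_{alg}(\mathcal B)$ is the distribution determined by $R_{\mathbb B_\alpha(\mu)}=\widehat{\mathrm{RB}}_\alpha(R_\mu)$. *)

(* Defs.v *)
From HB Require Import structures.
From mathcomp Require Import all_boot all_order all_algebra.
From mathcomp Require Import generic_quotient complex.
From mathcomp Require Import boolp reals.

Set Implicit Arguments.
Unset Strict Implicit.
Unset Printing Implicit Defensive.

Import Order.TTheory GRing.Theory Num.Theory.
Import ComplexField.
Local Open Scope ring_scope.
Local Open Scope quotient_scope.

(* The norm is a field of the structure and completeness is spelled out with   *)
(* Cauchy sequences: Hierarchy Builder cannot join algType with the normed      *)
(* modules of MathComp-Analysis, as numDomainType already inherits from both    *)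
(* hierarchies.                                                                 *)
HB.mixin Record Algebra_isCStarAlgebra (R : realType) B
    & GRing.Algebra R[i] B := {
  star : B -> B;
  cnorm : B -> R;
  cnormD : forall x y : B, cnorm (x + y) <= cnorm x + cnorm y;
  cnormZ : forall (a : R[i]) (x : B), cnorm (a *: x) = Normc.normc a * cnorm x;
  cnorm_eq0 : forall x : B, cnorm x = 0 -> x = 0;
  cnormM : forall x y : B, cnorm (x * y) <= cnorm x * cnorm y;
  cnorm_complete : forall u : nat -> B,
    (forall e, 0 < e -> exists N, forall m n,
       (N <= m)%N -> (N <= n)%N -> cnorm (u m - u n) < e) ->
    exists l, forall e, 0 < e -> exists N, forall n,
       (N <= n)%N -> cnorm (u n - l) < e;
  starD : forall x y : B, star (x + y) = star x + star y;
  starZ : forall (a : R[i]) (x : B), star (a *: x) = conjc a *: star x;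
  starM : forall x y : B, star (x * y) = star y * star x;
  starK : forall x : B, star (star x) = x;
  cnorm_star : forall x : B, cnorm (star x * x) = cnorm x ^+ 2
}.

#[short(type="cstarAlgType")]
HB.structure Definition CStarAlgebra (R : realType) :=
  {B of GRing.Algebra R[i] B & Algebra_isCStarAlgebra R B}.

Section PolyX.
Variables (K : comNzRingType) (B : algType K).

Inductive pexpr : Type :=
| PConst of B
| PVar
| PAdd of pexpr & pexpr
| PMul of pexpr & pexpr.

Inductive pcong : pexpr -> pexpr -> Prop :=
| pcong_refl p : pcong p p
| pcong_sym p q : pcong p q -> pcong q p
| pcong_trans p q r : pcong p q -> pcong q r -> pcong p r
| pcong_add p p' q q' :
    pcong p p' -> pcong q q' -> pcong (PAdd p q) (PAdd p' q')
| pcong_mul p p' q q' :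
    pcong p p' -> pcong q q' -> pcong (PMul p q) (PMul p' q')
| pcong_addA p q r : pcong (PAdd p (PAdd q r)) (PAdd (PAdd p q) r)
| pcong_addC p q : pcong (PAdd p q) (PAdd q p)
| pcong_add0 p : pcong (PAdd (PConst 0) p) p
| pcong_addN p : pcong (PAdd (PMul (PConst (- 1)) p) p) (PConst 0)
| pcong_mulA p q r : pcong (PMul p (PMul q r)) (PMul (PMul p q) r)
| pcong_mul1l p : pcong (PMul (PConst 1) p) p
| pcong_mul1r p : pcong (PMul p (PConst 1)) p
| pcong_mulDl p q r : pcong (PMul (PAdd p q) r) (PAdd (PMul p r) (PMul q r))
| pcong_mulDr p q r : pcong (PMul p (PAdd q r)) (PAdd (PMul p q) (PMul p r))
| pcong_constD b c : pcong (PConst (b + c)) (PAdd (PConst b) (PConst c))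
| pcong_constM b c : pcong (PConst (b * c)) (PMul (PConst b) (PConst c))
| pcong_scalar (k : K) p :
    pcong (PMul (PConst k%:A) p) (PMul p (PConst k%:A)).

HB.instance Definition _ := gen_eqMixin pexpr.
HB.instance Definition _ := gen_choiceMixin pexpr.

Definition pcongb : rel pexpr := fun p q => `[< pcong p q >].

Lemma pcongb_equiv : equiv_class_of pcongb.
Proof.
split => [p|p q|q p r].
- by apply/asboolP; exact: pcong_refl.
- by apply/asboolP/asboolP => h; exact: pcong_sym.
- by move=> /asboolP pq /asboolP qr; apply/asboolP; apply: pcong_trans pq qr.
Qed.

Canonical pcong_equivRel := EquivRelPack pcongb_equiv.

Definition polyX : Type := {eq_quot pcongb}%qT.
HB.instance Definition _ := Choice.on polyX.
HB.instance Definition _ := EqQuotient.on polyX.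

Definition polyX_of (p : pexpr) : polyX := \pi_polyX p.
Local Notation pi := polyX_of.

Lemma piP p q : pi p = pi q <-> pcong p q.
Proof.
split=> [/eqmodP /asboolP //|h]; apply/eqmodP; exact/asboolP.
Qed.

Lemma polyX_elim (P : polyX -> Prop) :
  (forall p, P (pi p)) -> forall x, P x.
Proof. by move=> Ppi x; rewrite -[x]reprK; exact: Ppi. Qed.

Lemma repr_pi p : pcong (repr (pi p)) p.
Proof. by apply/piP; rewrite /polyX_of reprK. Qed.

Let add (p q : polyX) : polyX := pi (PAdd (repr p) (repr q)).
Let mul (p q : polyX) : polyX := pi (PMul (repr p) (repr q)).

Let pi_add p q : pi (PAdd p q) = add (pi p) (pi q).
Proof. by apply/piP/pcong_sym/pcong_add; exact: repr_pi. Qed.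
Let pi_mul p q : pi (PMul p q) = mul (pi p) (pi q).
Proof. by apply/piP/pcong_sym/pcong_mul; exact: repr_pi. Qed.

Let zero : polyX := pi (PConst 0).
Let one : polyX := pi (PConst 1).
Let opp (p : polyX) : polyX := mul (pi (PConst (- 1))) p.

Let px_addA : associative add.
Proof.
elim/polyX_elim => p; elim/polyX_elim => q; elim/polyX_elim => r.
by rewrite -!pi_add; apply/piP; exact: pcong_addA.
Qed.
Let px_addC : commutative add.
Proof.
by elim/polyX_elim => p; elim/polyX_elim => q; rewrite -!pi_add; apply/piP; exact: pcong_addC.
Qed.
Let px_add0 : left_id zero add.
Proof. by elim/polyX_elim => p; rewrite -pi_add; apply/piP; exact: pcong_add0. Qed.
Let px_addN : left_inverse zero opp add.
Proof. by elim/polyX_elim => p; rewrite /opp -pi_mul -pi_add; apply/piP; exact: pcong_addN. Qed.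

HB.instance Definition _ := GRing.isZmodule.Build polyX px_addA px_addC px_add0 px_addN.

Let pi_addR p q : pi (PAdd p q) = pi p + pi q.
Proof. exact: pi_add. Qed.

Let px_mulA : associative mul.
Proof.
elim/polyX_elim => p; elim/polyX_elim => q; elim/polyX_elim => r.
by rewrite -!pi_mul; apply/piP; exact: pcong_mulA.
Qed.
Let px_mul1l : left_id one mul.
Proof. by elim/polyX_elim => p; rewrite -pi_mul; apply/piP; exact: pcong_mul1l. Qed.
Let px_mul1r : right_id one mul.
Proof. by elim/polyX_elim => p; rewrite -pi_mul; apply/piP; exact: pcong_mul1r. Qed.
Let px_mulDl : left_distributive mul +%R.
Proof.
elim/polyX_elim => p; elim/polyX_elim => q; elim/polyX_elim => r.
by rewrite -pi_addR -!pi_mul -pi_addR; apply/piP; exact: pcong_mulDl.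
Qed.
Let px_mulDr : right_distributive mul +%R.
Proof.
elim/polyX_elim => p; elim/polyX_elim => q; elim/polyX_elim => r.
by rewrite -pi_addR -!pi_mul -pi_addR; apply/piP; exact: pcong_mulDr.
Qed.

Fixpoint peval0 (p : pexpr) : B :=
  match p with
  | PConst b => b
  | PVar => 0
  | PAdd p q => peval0 p + peval0 q
  | PMul p q => peval0 p * peval0 q
  end.

Let peval0_cong p q : pcong p q -> peval0 p = peval0 q.
Proof.
elim=> {p q} //= *; try congruence.
all: rewrite ?mulN1r ?addNr ?add0r ?mul1r ?mulr1 ?mulr_algl ?mulr_algr //.
all: by rewrite ?mulrDl ?mulrDr ?mulrA ?addrA // addrC.
Qed.

Let one_neq0 : one != 0.
Proof.
apply/eqP => /piP /peval0_cong /= /eqP.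
by rewrite oner_eq0.
Qed.

HB.instance Definition _ :=
  GRing.Zmodule_isNzRing.Build polyX px_mulA px_mul1l px_mul1r px_mulDl px_mulDr one_neq0.

Let scale (k : K) (p : polyX) : polyX := pi (PConst k%:A) * p.

Lemma polyX_ofCM b c :
  pi (PConst (b * c)) = pi (PConst b) * pi (PConst c).
Proof. by rewrite -[RHS]pi_mul; apply/piP; exact: pcong_constM. Qed.
Lemma polyX_ofCD b c :
  pi (PConst (b + c)) = pi (PConst b) + pi (PConst c).
Proof. by rewrite -[RHS]pi_add; apply/piP; exact: pcong_constD. Qed.

Let scaleA a b v : scale a (scale b v) = scale (a * b) v.
Proof. by rewrite /scale mulrA -polyX_ofCM -scalerAl mul1r scalerA. Qed.
Let scale1 : left_id 1 scale.
Proof. by move=> p; rewrite /scale scale1r mul1r. Qed.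
Let scaleDr : right_distributive scale +%R.
Proof. by move=> k p q; rewrite /scale mulrDr. Qed.
Let scaleDl v : {morph scale^~ v : a b / a + b}.
Proof. by move=> a b; rewrite /scale scalerDl polyX_ofCD mulrDl. Qed.

HB.instance Definition _ :=
  GRing.Zmodule_isLmodule.Build K polyX scaleA scale1 scaleDr scaleDl.

Let scaleAl (k : K) (u v : polyX) : k *: (u * v) = k *: u * v.
Proof. exact: mulrA. Qed.
HB.instance Definition _ := GRing.Lmodule_isLalgebra.Build K polyX scaleAl.

Let scaleAr (k : K) (u v : polyX) : k *: (u * v) = u * (k *: v).
Proof.
rewrite -[LHS]/(pi (PConst k%:A) * (u * v)).
rewrite -[k *: v]/(pi (PConst k%:A) * v) !mulrA; congr (_ * _).
elim/polyX_elim: u => u.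
by rewrite -[LHS]pi_mul -[RHS]pi_mul; apply/piP; exact: pcong_scalar.
Qed.
HB.instance Definition _ := GRing.Lalgebra_isAlgebra.Build K polyX scaleAr.

Lemma polyX_ofD p q : pi (PAdd p q) = pi p + pi q.
Proof. exact: pi_addR. Qed.

Lemma polyX_ofM p q : pi (PMul p q) = pi p * pi q.
Proof. exact: pi_mul. Qed.

Definition constX (b : B) : polyX := pi (PConst b).
Definition varX : polyX := pi PVar.

End PolyX.

Section Multilinear.
Variables (K : comNzRingType) (B : algType K).

(* A map on \bigsqcup_n B^n, encoded as a map on seq B, whose restriction to    *)
(* each B^n is K-multilinear.                                                   *)
Definition multilinear (V : lmodType K) (f : seq B -> V) : Prop :=
  forall u v, linear (fun b => f (u ++ b :: v)).

Section Lemmas.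
Variables (V : lmodType K) (f : seq B -> V).
Hypothesis f_lin : multilinear f.

Lemma multilinear0 u v : f (u ++ 0 :: v) = 0.
Proof.
have := f_lin u v 1 0 0; rewrite scaler0 addr0 scale1r => h.
by apply: (addrI (f (u ++ 0 :: v))); rewrite addr0 -h.
Qed.

Lemma multilinearD u v x y :
  f (u ++ (x + y) :: v) = f (u ++ x :: v) + f (u ++ y :: v).
Proof. by have := f_lin u v 1 x y; rewrite !scale1r. Qed.

Lemma multilinearZ u v k x : f (u ++ (k *: x) :: v) = k *: f (u ++ x :: v).
Proof.
by have := f_lin u v k x 0; rewrite addr0 multilinear0 addr0.
Qed.
End Lemmas.

Lemma multilinear_sum (V : lmodType K) (I : Type) (r : seq I) (P : pred I)
    (f : I -> seq B -> V) :
  (forall i, multilinear (f i)) ->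
  multilinear (fun w => \sum_(i <- r | P i) f i w).
Proof.
move=> flin u v a x y; rewrite scaler_sumr -big_split /=.
by apply: eq_bigr => i _; exact: flin.
Qed.

End Multilinear.

Section FreeProduct.
Variables (K : comNzRingType) (B : algType K).
Local Notation BX := (polyX B).
Local Notation pi := (@polyX_of K B).
Local Notation X := (varX B).

Lemma constXD (b c : B) : constX (b + c) = constX b + constX c :> BX.
Proof. exact: polyX_ofCD. Qed.

Lemma constXM (b c : B) : constX (b * c) = constX b * constX c :> BX.
Proof. exact: polyX_ofCM. Qed.

Lemma constX1 : constX 1 = 1 :> BX.
Proof. by []. Qed.

Lemma constXZ (k : K) (b : B) : constX (k *: b) = k *: constX b :> BX.
Proof. by rewrite -mulr_algl constXM. Qed.

(* [:: b0; ...; bn] stands for b0 X b1 ... X bn. *)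
Definition monom (w : seq B) : BX :=
  if w is b :: s then foldl (fun p c => p * X * constX c) (constX b) s else 0.

Definition wmul (u v : seq B) : seq B :=
  take (size u).-1 u ++ (last 0 u * head 0 v) :: behead v.

Lemma wmul_rcons u x y v : wmul (rcons u x) (y :: v) = u ++ (x * y) :: v.
Proof.
by rewrite /wmul size_rcons /= last_rcons -cats1 take_size_cat.
Qed.

Lemma wmulA u x y v z t :
  wmul (rcons u x) (wmul (y :: v) (z :: t))
  = wmul (wmul (rcons u x) (y :: v)) (z :: t).
Proof.
rewrite [wmul (rcons u x) (y :: v)]wmul_rcons.
case/lastP: v => [|v c]; first by rewrite cats1 !wmul_rcons mulrA.
rewrite -rcons_cons wmul_rcons cat_cons wmul_rcons.
by rewrite -rcons_cons -rcons_cat wmul_rcons -catA.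
Qed.

Fixpoint expand (p : pexpr B) : seq (seq B) :=
  match p with
  | PConst b => [:: [:: b]]
  | PVar => [:: [:: 1; 1]]
  | PAdd p q => expand p ++ expand q
  | PMul p q => [seq wmul u v | u <- expand p, v <- expand q]
  end.

Lemma expand_neq0 p w : w \in expand p -> w != [::].
Proof.
elim: p w => [b|| p IHp q IHq | p IHp q IHq] w /=; rewrite ?inE.
- by move/eqP->.
- by move/eqP->.
- by rewrite mem_cat => /orP[/IHp|/IHq].
- by case/allpairsP => -[u v] [_ _ ->]; rewrite /wmul; case: (take _ _).
Qed.

Lemma wordP (w : seq B) : w != [::] -> exists u x, w = rcons u x.
Proof. by case/lastP: w => // u x _; exists u, x. Qed.

Section Eval.
Variable V : lmodType K.
Implicit Type f : seq B -> V.

Definition pev f (p : pexpr B) : V := \sum_(w <- expand p) f w.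

Lemma pev_mul f p q :
  pev f (PMul p q) = pev (fun u => pev (fun v => f (wmul u v)) q) p.
Proof. by rewrite /pev /= big_allpairs_dep. Qed.

Lemma multilinear_wmull f v : multilinear f -> multilinear (fun u => f (wmul u v)).
Proof.
move=> flin u1 u2 a x y.
case/lastP: u2 => [|u2 z].
  have E t : wmul (u1 ++ [:: t]) v = u1 ++ (t * head 0 v) :: behead v.
    by rewrite cats1 -wmul_rcons /wmul.
  by rewrite !E mulrDl -scalerAl flin.
have E t : wmul (u1 ++ t :: rcons u2 z) v
    = u1 ++ t :: (u2 ++ (z * head 0 v) :: behead v).
  by rewrite -rcons_cons -rcons_cat -[u1 ++ t :: _]/(_ ++ _) -cat_cons catA
             -wmul_rcons /wmul.
by rewrite !E flin.
Qed.

Lemma multilinear_wmulr f u : multilinear f -> multilinear (fun v => f (wmul u v)).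
Proof.
move=> flin v1 v2 a x y.
case: v1 => [|z v1]; rewrite /wmul /=; first by rewrite mulrDr -scalerAr flin.
have E t : take (size u).-1 u ++ last 0 u * z :: v1 ++ t :: v2
    = (take (size u).-1 u ++ last 0 u * z :: v1) ++ t :: v2 by rewrite -catA.
by rewrite !E flin.
Qed.

Lemma pev_cong p q : pcong p q -> forall f, multilinear f -> pev f p = pev f q.
Proof.
have neq0 (r : pexpr B) (f g : seq B -> V) :
    (forall y v, f (y :: v) = g (y :: v)) -> pev f r = pev g r.
  move=> fg; apply: eq_big_seq => w /expand_neq0.
  by case: w => // y v _; exact: fg.
have neq0r (r : pexpr B) (f g : seq B -> V) :
    (forall v y, f (rcons v y) = g (rcons v y)) -> pev f r = pev g r.
  move=> fg; apply: eq_big_seq => w /expand_neq0.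
  by case/lastP: w => // v y _; exact: fg.
have pevC f b : pev f (PConst b) = f [:: b] by rewrite /pev big_seq1.
have pevD f p' q' : pev f (PAdd p' q') = pev f p' + pev f q'.
  by rewrite /pev /= big_cat.
have wE x y v : wmul [:: x] (y :: v) = x * y :: v by [].
have E0 f y v : f (y :: v) = f ([::] ++ y :: v) by [].
elim=> {p q}.
- by [].
- by move=> p q _ IH f flin; rewrite IH.
- by move=> p q r _ IH1 _ IH2 f flin; rewrite IH1 // IH2.
- by move=> p p' q q' _ IH1 _ IH2 f flin; rewrite !pevD IH1 // IH2.
- move=> p p' q q' _ IH1 _ IH2 f flin; rewrite !pev_mul.
  rewrite IH1; last by apply: multilinear_sum => v; exact: multilinear_wmull.
  by apply: eq_bigr => u _; apply: IH2; exact: multilinear_wmulr.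
- by move=> p q r f flin; rewrite !pevD addrA.
- by move=> p q f flin; rewrite !pevD addrC.
- move=> p f flin; rewrite pevD pevC E0 multilinear0 // add0r //.
- move=> p f flin; rewrite pevD pev_mul !pevC E0 multilinear0 //.
  rewrite -big_split /= big1_seq // => w /= /expand_neq0.
  case: w => // y v _; rewrite wE mulN1r -scaleN1r !E0 multilinearZ //.
  by rewrite scaleN1r addNr.
- move=> p q r f flin; rewrite !pev_mul.
  apply: neq0r => u x; rewrite pev_mul.
  rewrite [RHS]/pev; apply: eq_big_seq => v /expand_neq0.
  case: v => // y v _; apply: neq0 => z t.
  by rewrite wmulA.
- move=> p f flin; rewrite pev_mul pevC; apply: neq0 => y v.
  by rewrite wE mul1r.
- move=> p f flin; rewrite pev_mul; apply: neq0r => v y.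
  by rewrite pevC wmul_rcons mulr1 cats1.
- move=> p q r f flin; rewrite pevD !pev_mul; exact: pevD.
- move=> p q r f flin; rewrite pevD !pev_mul -big_split.
  by apply: eq_bigr => u _; exact: pevD.
- by move=> b c f flin; rewrite pevD !pevC !E0 multilinearD.
- by move=> b c f flin; rewrite pev_mul !pevC.
- move=> k p f flin; rewrite !pev_mul pevC.
  transitivity (k *: pev f p).
    rewrite scaler_sumr; apply: eq_big_seq => w /expand_neq0.
    by case: w => // y v _; rewrite wE mulr_algl !E0 multilinearZ.
  rewrite scaler_sumr; apply: eq_big_seq => w /expand_neq0.
  case/lastP: w => // v y _.
  by rewrite pevC wmul_rcons mulr_algr multilinearZ // cats1.
Qed.

End Eval.

Lemma expand_monom b s :
  expand (foldl (fun p c => PMul (PMul p (PVar B)) (PConst c)) (PConst b) s)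
  = [:: b :: s].
Proof.
elim/last_ind: s => [//|s c IH]; rewrite foldl_rcons /= IH /=.
case/lastP: s {IH} => [|s x]; first by rewrite /wmul /= mulr1 mul1r.
rewrite -rcons_cons wmul_rcons mulr1 -[_ ++ _]/(_ ++ [:: x] ++ [:: 1]) catA.
by rewrite !cats1 wmul_rcons mul1r cats1.
Qed.

Lemma monomE b s : monom (b :: s) =
  pi (foldl (fun p c => PMul (PMul p (PVar B)) (PConst c)) (PConst b) s).
Proof.
elim/last_ind: s => [//|s c IH].
by rewrite /monom !foldl_rcons -[foldl _ _ s]/(monom (b :: s)) IH !polyX_ofM.
Qed.

Lemma monomM u v : u != [::] -> v != [::] ->
  monom u * monom v = monom (wmul u v).
Proof.
case/wordP => u' [x ->]; case: v => // y v _; rewrite wmul_rcons.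
have E (p q : BX) : p * foldl (fun p c => p * X * constX c) q v
             = foldl (fun p c => p * X * constX c) (p * q) v.
  by elim: v q => [//|c v IH] q /=; rewrite IH !mulrA.
case: u' => [|b u'] /=; first by rewrite E constXM.
by rewrite foldl_rcons foldl_cat /= E constXM mulrA.
Qed.

Lemma pi_expand p : pi p = \sum_(w <- expand p) monom w :> BX.
Proof.
elim: p => [b||p IHp q IHq|p IHp q IHq] /=.
- by rewrite big_seq1.
- by rewrite big_seq1 /= constX1 mul1r mulr1.
- by rewrite big_cat -IHp -IHq polyX_ofD.
- rewrite big_allpairs_dep /= polyX_ofM IHp IHq mulr_suml.
  apply: eq_big_seq => u /expand_neq0 u0; rewrite mulr_sumr.
  by apply: eq_big_seq => v /expand_neq0 v0; rewrite monomM.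
Qed.

(* The last two lemmas of this section say that polyX B is the direct sum over  *)
(* n of the spans of the monomials of degree n, and that these spans are the    *)
(* tensor powers of B.                                                          *)
Lemma polyX_span (p : BX) : exists2 ws : seq (seq B),
  p = \sum_(w <- ws) monom w & forall w, w \in ws -> w != [::].
Proof.
elim/polyX_elim: p => p; exists (expand p); first exact: pi_expand.
by move=> w; exact: expand_neq0.
Qed.

Lemma polyX_lift (V : lmodType K) (f : seq B -> V) : multilinear f ->
  exists2 g : BX -> V, linear g & forall b s, g (monom (b :: s)) = f (b :: s).
Proof.
move=> flin; exists (fun x => pev f (repr x)).
  have E p : pev f (repr (pi p)) = pev f p.
    by apply: pev_cong => //; exact: repr_pi.
  move=> k; elim/polyX_elim => p; elim/polyX_elim => q.
  have -> : k *: (pi p : BX) + pi q = pi (PAdd (PMul (PConst k%:A) p) q).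
    by rewrite polyX_ofD polyX_ofM.
  rewrite !E /pev /= big_cat; congr (_ + _).
  rewrite cats0 big_map scaler_sumr; apply: eq_big_seq => w /expand_neq0.
  case: w => // y v _; rewrite -[wmul _ _]/(k%:A * y :: v) mulr_algl.
  exact: (multilinearZ flin [::]).
move=> b s; rewrite monomE (pev_cong (repr_pi _)) //.
by rewrite /pev expand_monom big_seq1.
Qed.

End FreeProduct.

Section Distributions.
Variables (K : comNzRingType) (B : algType K).
Local Notation BX := (polyX B).
Local Notation X := (varX B).

Record distr := Distr {
  dfun :> BX -> B;
  dfun_linear : linear dfun;
  dfun_bimodl : forall (b : B) (p : BX), dfun (constX b * p) = b * dfun p;
  dfun_bimodr : forall (p : BX) (b : B), dfun (p * constX b) = dfun p * b;
  dfun_const : forall b : B, dfun (constX b) = b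
}.

HB.instance Definition _ (mu : distr) :=
  GRing.isLinear.Build K BX B _ (dfun mu) (dfun_linear mu).

(* The value at [:: b1; ...; bm] of a series F is F^[m+1](b1, ..., bm). *)
Record series := Series {
  sfun :> seq B -> B;
  sfun_multilinear : multilinear sfun
}.

Lemma distrP (mu nu : distr) : mu =1 nu -> mu = nu.
Proof.
case: mu nu => [f f1 f2 f3 f4] [g g1 g2 g3 g4] /= /funext fg.
by case: g / fg in g1 g2 g3 g4 *; congr Distr; exact: Prop_irrelevance.
Qed.

Lemma seriesP (F G : series) : F =1 G -> F = G.
Proof.
case: F G => [f f1] [g g1] /= /funext fg.
by case: g / fg in g1 *; congr Series; exact: Prop_irrelevance.
Qed.

Lemma comp_series_subproof (alpha : {linear B -> B}) (F : series) :
  multilinear (alpha \o F).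
Proof. by move=> u v a x y /=; rewrite (sfun_multilinear F) linearP. Qed.

Definition comp_series alpha F := Series (comp_series_subproof alpha F).

(* X b1 X ... bm X *)
Definition moment_word (s : seq B) : BX :=
  foldl (fun p b => p * constX b * X) X s.

Lemma moment_wordE u v :
  moment_word (u ++ v) = foldl (fun p b => p * constX b * X) (moment_word u) v.
Proof. exact: foldl_cat. Qed.

Lemma foldl_moment_linear v : linear (foldl (fun (p : BX) b => p * constX b * X) ^~ v).
Proof.
elim: v => [|c v IH] a x y //=.
by rewrite !mulrDl -!scalerAl IH.
Qed.

Lemma moment_series_subproof (mu : distr) :
  multilinear (fun s => mu (moment_word s)).
Proof.
move=> u v a x y; rewrite !moment_wordE /= constXD constXZ mulrDr -scalerAr.
by rewrite mulrDl -scalerAl foldl_moment_linear linearP.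
Qed.

Definition moment_series mu := Series (moment_series_subproof mu).

Lemma monom_moment b s c :
  monom (b :: rcons s c) = constX b * moment_word s * constX c :> BX.
Proof.
rewrite /monom foldl_rcons; congr (_ * _).
elim/last_ind: s => [//|s d IH].
by rewrite foldl_rcons /moment_word foldl_rcons IH !mulrA.
Qed.

Let word_value (M : series) (w : seq B) : B :=
  if w is b :: s then
    if s is c :: t then b * M (belast c t) * last c t else b
  else 0.

Let word_value_rcons M b s c : word_value M (b :: rcons s c) = b * M s * c.
Proof. by case: s => [|d s] //=; rewrite last_rcons belast_rcons. Qed.

Let word_value_multilinear M : multilinear (word_value M).
Proof.
move=> u v a x y; case: u => [|b u].
  case/lastP: v => [|v c] //.
  by rewrite !cat0s !word_value_rcons !mulrDl -!scalerAl.
case/lastP: v => [|v c].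
  by rewrite !cat_cons !cats1 !word_value_rcons mulrDr -scalerAr.
rewrite !cat_cons -!rcons_cons -!rcons_cat !word_value_rcons.
by rewrite sfun_multilinear mulrDr -scalerAr mulrDl -scalerAl.
Qed.

Lemma moment_series_bij (M : series) : exists! mu : distr, moment_series mu = M.
Proof.
have [g glin gE] := polyX_lift (word_value_multilinear M).
pose gL : {linear BX -> B} := HB.pack g (GRing.isLinear.Build K BX B _ g glin).
have gl b p : g (constX b * p) = b * g p.
  have [ws -> ws0] := polyX_span p.
  rewrite -![g]/(gL : _ -> _) mulr_sumr !linear_sum mulr_sumr /=.
  apply: eq_big_seq => w /ws0; case: w => // c s _.
  have -> : constX b * monom (c :: s) = monom (b * c :: s).
    by rewrite -[constX b]/(monom [:: b]) monomM.
  by rewrite !gE; case: s => [//|d s] /=; rewrite !mulrA.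
have gr p b : g (p * constX b) = g p * b.
  have [ws -> ws0] := polyX_span p.
  rewrite -![g]/(gL : _ -> _) mulr_suml !linear_sum mulr_suml /=.
  apply: eq_big_seq => w /ws0; case/lastP: w => // s c _.
  have -> : monom (rcons s c) * constX b = monom (rcons s (c * b)).
    rewrite -[constX b]/(monom [:: b]) monomM //; last by case: s.
    by rewrite wmul_rcons cats1.
  case: s => [|d s]; first by rewrite (gE (c * b) [::]) (gE c [::]).
  by rewrite (gE d (rcons s (c * b))) (gE d (rcons s c)) !word_value_rcons mulrA.
have gc b : g (constX b) = b by rewrite -[constX b]/(monom [:: b]) gE.
exists (Distr glin gl gr gc); split.
  apply: seriesP => s /=.
  have -> : moment_word s = monom (1 :: rcons s 1).
    by rewrite monom_moment constX1 mul1r mulr1.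
  by rewrite gE word_value_rcons mul1r mulr1.
move=> mu muM; apply: distrP => p /=.
have [ws -> ws0] := polyX_span p.
rewrite -[g]/(gL : _ -> _) !linear_sum; apply: eq_big_seq => w /ws0 /=.
case: w => // b s _; rewrite gE; case/lastP: s => [|s c].
  by rewrite dfun_const.
rewrite word_value_rcons monom_moment dfun_bimodr dfun_bimodl.
by rewrite -muM.
Qed.

End Distributions.

Definition noncrossing n (p : {set {set 'I_n}}) : bool :=
  partition p [set: 'I_n] &&
  [forall V in p, forall W in p, forall i in V, forall j in W,
     forall k in V, forall l in W, (i < j < k)%N && (k < l)%N ==> (V == W)].

Definition NC n : {set {set {set 'I_n}}} := [set p | noncrossing p].

Definition is_interval n (V : {set 'I_n}) : bool :=
  [forall i in V, forall k in V, forall j : 'I_n, (i < j < k)%N ==> (j \in V)].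

Definition IntP n : {set {set {set 'I_n}}} :=
  [set p | partition p [set: 'I_n] & [forall V in p, is_interval V]].

Section Nested.
Variables (K : comNzRingType) (B : algType K).

(* The string W_1 b_1 W_2 ... b_{n-1} W_n, with a token for each W_m: [F^{k}(], *)
(* a comma, a closing parenthesis, or F^[1].                                    *)
Inductive token :=
| Coef of B
| Open of (seq B -> B)
| Comma
| Close
| Unary of (seq B -> B).

(* The reader of parenthesized expressions. acc is the product of what has been *)
(* read so far at the current level; each pending F^[k]( is on the stack        *)
(* together with the product read before it and its completed arguments.        *)
(* Ill-formed strings, which do not arise from partitions in NC(n), are sent    *)
(* to 0.                                                                        *)
Fixpoint read (acc : B) (stk : seq (B * (seq B -> B) * seq B))
    (ts : seq token) : B :=
  match ts with
  | [::] => if stk is [::] then acc else 0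
  | Coef b :: ts => read (acc * b) stk ts
  | Unary F :: ts => read (acc * F [::]) stk ts
  | Open F :: ts => read 1 ((acc, F, [::]) :: stk) ts
  | Comma :: ts =>
      if stk is (a, F, args) :: stk then
        read 1 ((a, F, rcons args acc) :: stk) ts
      else 0
  | Close :: ts =>
      if stk is (a, F, args) :: stk then
        read (a * F (rcons args acc)) stk ts
      else 0
  end.

Definition is_min n (V : {set 'I_n}) (m : 'I_n) : bool :=
  [forall i in V, (m <= i)%N].
Definition is_max n (V : {set 'I_n}) (m : 'I_n) : bool :=
  [forall i in V, (i <= m)%N].

(* H assigns to each block V the series whose entry of order #|V| is written    *)
(* for V.                                                                       *)
Definition letter n (H : {set 'I_n} -> seq B -> B) (p : {set {set 'I_n}})
    (m : 'I_n) : token :=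
  let V := pblock p m in
  if #|V| == 1%N then Unary (H V)
  else if is_min V m then Open (H V)
  else if is_max V m then Close
  else Comma.

Definition string n (H : {set 'I_n.+1} -> seq B -> B)
    (p : {set {set 'I_n.+1}}) (s : seq B) : seq token :=
  letter H p ord0 ::
  flatten [seq [:: Coef (nth 0 s i); letter H p (lift ord0 i)]
          | i : 'I_n <- enum 'I_n].

Definition nested n H p s : B := read 1 [::] (@string n H p s).

Definition mono_nested n (F : seq B -> B) (p : {set {set 'I_n.+1}}) : seq B -> B :=
  nested (fun=> F) p.

Inductive colour := colour1 | colour2.

Definition coloured_nested n (F G : seq B -> B) (p : {set {set 'I_n.+1}})
    (c : {set 'I_n.+1} -> colour) : seq B -> B :=
  nested (fun V => if c V is colour1 then F else G) p.

Definition outer_block n (p : {set {set 'I_n.+1}}) : {set 'I_n.+1} :=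
  pblock p ord0.

Definition ll1 n (p : {set {set 'I_n.+1}}) : bool :=
  ord_max \in outer_block p.

Definition outer_colouring n (p : {set {set 'I_n.+1}}) (V : {set 'I_n.+1}) :
    colour :=
  if V == outer_block p then colour1 else colour2.

Let token_multilinear (t : token) : Prop :=
  match t with Open F | Unary F => multilinear F | _ => True end.

Fixpoint all_multilinear (ts : seq token) : Prop :=
  if ts is t :: ts then token_multilinear t /\ all_multilinear ts else True.

Fixpoint stk_multilinear (stk : seq (B * (seq B -> B) * seq B)) : Prop :=
  if stk is (_, F, _) :: stk then multilinear F /\ stk_multilinear stk else True.

Lemma stk_multilinear_cat s1 s2 : stk_multilinear (s1 ++ s2) <->
  stk_multilinear s1 /\ stk_multilinear s2.
Proof.
elim: s1 => [|[[a F] args] s1 IH] /=; first by split=> // -[].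
by rewrite IH; tauto.
Qed.

Lemma read_linear ts : all_multilinear ts ->
  [/\ forall stk, stk_multilinear stk -> linear (fun x => read x stk ts),
      forall acc s1 F args s2, stk_multilinear (s1 ++ (0, F, args) :: s2) ->
        linear (fun x => read acc (s1 ++ (x, F, args) :: s2) ts)
    & forall acc s1 a F u v s2, stk_multilinear (s1 ++ (a, F, u ++ v) :: s2) ->
        linear (fun x => read acc (s1 ++ (a, F, u ++ x :: v) :: s2) ts)].
Proof.
elim: ts => [_|t ts IH [tlin /IH{IH} [IHacc IHout IHarg]]].
  split=> [stk _|acc s1 F args s2 _|acc s1 a F u v s2 _] k x y /=.
  - by case: stk => [//|fr stk]; rewrite scaler0 addr0.
  - by case: s1 => [|fr s1]; rewrite /= scaler0 addr0.
  - by case: s1 => [|fr s1]; rewrite /= scaler0 addr0.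
case: t tlin => [b _|F Flin|_|_|F Flin].
- split=> [stk Hs|acc s1 F args s2 Hs|acc s1 a F u v s2 Hs] k x y /=.
  + by rewrite mulrDl -scalerAl IHacc.
  + by rewrite IHout.
  + by rewrite IHarg.
- split=> [stk Hs|acc s1 G args s2 Hs|acc s1 a G u v s2 Hs] k x y /=.
  + by have := @IHout 1 [::] F [::] stk (conj Flin Hs) k x y.
  + by have := @IHout 1 ((acc, F, [::]) :: s1) G args s2 (conj Flin Hs) k x y.
  + by have := @IHarg 1 ((acc, F, [::]) :: s1) a G u v s2 (conj Flin Hs) k x y.
- split=> [stk Hs|acc s1 G args s2 Hs|acc s1 a G u v s2 Hs] k x y /=.
  + case: stk Hs => [|[[a F] args] stk] Hs; first by rewrite scaler0 addr0.
    have := @IHarg 1 [::] a F args [::] stk.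
    by rewrite cats0 => /(_ Hs k x y); rewrite /= !cats1.
  + case: s1 Hs => [|[[b F] args'] s1] Hs /=.
      exact: (@IHout 1 [::] G (rcons args acc) s2).
    exact: (@IHout 1 ((b, F, rcons args' acc) :: s1) G args s2).
  + case: s1 Hs => [|[[b F] args'] s1] Hs /=.
      have := @IHarg 1 [::] a G u (rcons v acc) s2 Hs k x y.
      by rewrite /= -!rcons_cons -!rcons_cat.
    exact: (@IHarg 1 ((b, F, rcons args' acc) :: s1) a G u v s2).
- split=> [stk Hs|acc s1 G args s2 Hs|acc s1 a G u v s2 Hs] k x y /=.
  + case: stk Hs => [|[[a F] args] stk] Hs; first by rewrite scaler0 addr0.
    case: Hs => Flin Hs; rewrite -!cats1 Flin mulrDr -scalerAr; exact: IHacc.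
  + case: s1 Hs => [|[[b F] args'] s1] Hs /=.
      by rewrite mulrDl -scalerAl; apply: IHacc; case: Hs.
    by apply: (@IHout _ s1 G args s2); case: Hs.
  + case: s1 Hs => [|[[b F] args'] s1] Hs /=.
      case: Hs => Glin Hs.
      by rewrite !rcons_cat !rcons_cons Glin mulrDr -scalerAr; exact: IHacc.
    by apply: (@IHarg _ s1 a G u v s2); case: Hs.
- split=> [stk Hs|acc s1 G args s2 Hs|acc s1 a G u v s2 Hs] k x y /=.
  + by rewrite mulrDl -scalerAl IHacc.
  + by rewrite IHout.
  + by rewrite IHarg.
Qed.

Lemma read_coef_linear ts1 ts2 acc :
  all_multilinear (ts1 ++ ts2) ->
  linear (fun x => read acc [::] (ts1 ++ Coef x :: ts2)).
Proof.
move=> ts_lin; have : stk_multilinear [::] by [].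
elim: ts1 ts_lin acc [::] => [|t ts1 IH] ts_lin acc stk Hs.
  move=> k x y /=; have [h _ _] := read_linear ts_lin.
  by rewrite mulrDr -scalerAr h.
case: ts_lin => tlin /IH{}IH k x y /=.
case: t tlin => [b _|F Flin|_|_|F Flin]; try exact: IH.
- case: stk Hs => [|[[a F] args] stk] Hs; first by rewrite scaler0 addr0.
  exact: IH.
- case: stk Hs => [|[[a F] args] stk] Hs; first by rewrite scaler0 addr0.
  by apply: IH; case: Hs.
Qed.

Lemma letter_multilinear n (H : {set 'I_n} -> series B) p m :
  token_multilinear (letter H p m).
Proof.
rewrite /letter; case: ifP => _; first exact: sfun_multilinear.
case: ifP => _; first exact: sfun_multilinear.
by case: ifP.
Qed.

Lemma all_multilinear_flatten (I : Type) (r : seq I) (f : I -> seq token) :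
  (forall i, all_multilinear (f i)) -> all_multilinear (flatten (map f r)).
Proof.
move=> fH; have catH ts1 ts2 : all_multilinear ts1 -> all_multilinear ts2 ->
  all_multilinear (ts1 ++ ts2).
  by elim: ts1 => //= t ts1 IH [? ?] ?; split=> //; exact: IH.
by elim: r => //= i r IH; exact: catH.
Qed.

Lemma nested_multilinear n (H : {set 'I_n.+1} -> series B) p u v k x y :
  size (u ++ 0 :: v) = n ->
  nested H p (u ++ (k *: x + y) :: v)
  = k *: nested H p (u ++ x :: v) + nested H p (u ++ y :: v).
Proof.
rewrite size_cat /= => un.
have i0P : (size u < n)%N by rewrite -un addnS ltnS leq_addr.
pose i0 := Ordinal i0P.
have [r1 [r2 [enumE r1P r2P]]] : exists r1 r2, [/\ enum 'I_n = r1 ++ i0 :: r2,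
    i0 \notin r1 & i0 \notin r2].
  have: uniq (enum 'I_n) by exact: enum_uniq.
  have: i0 \in enum 'I_n by rewrite mem_enum.
  case/splitPr => r1 r2; rewrite cat_uniq /= => /and3P[_ /norP[i01 _] /andP[i02 _]].
  by exists r1, r2.
pose f z (i : 'I_n) := [:: Coef (nth 0 (u ++ z :: v) i); letter H p (lift ord0 i)].
have nthE z (i : 'I_n) : i != i0 ->
    nth 0 (u ++ z :: v) i = nth 0 (u ++ 0 :: v) i.
  rewrite -val_eqE /= !nth_cat => ii0; case: ltngtP ii0 => // ui _.
  by case: (i - size u)%N (subn_gt0 (size u) i) => //; rewrite ui.
have mapE z r : i0 \notin r -> [seq f z i | i <- r] = [seq f 0 i | i <- r].
  move=> i0r; apply/eq_in_map => i ir; rewrite /f nthE //.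
  by apply: contraNneq i0r => <-.
pose ts1 := letter H p ord0 :: flatten [seq f 0 i | i <- r1].
pose ts2 := letter H p (lift ord0 i0) :: flatten [seq f 0 i | i <- r2].
have E z : nested H p (u ++ z :: v) = read 1 [::] (ts1 ++ Coef z :: ts2).
  rewrite /nested /string enumE map_cat flatten_cat /=.
  by rewrite -!/(f z _) !mapE // nth_cat ltnn subnn.
rewrite !E; apply: read_coef_linear; split; first exact: letter_multilinear.
rewrite -[_ ++ ts2]/(_ ++ ([:: letter H p (lift ord0 i0)] ++ _)).
have fH i : all_multilinear (f 0 i) by split=> //; split=> //; exact: letter_multilinear.
rewrite -/(flatten [:: [:: letter H p (lift ord0 i0)]]).
have catH ts ts' : all_multilinear ts -> all_multilinear ts' ->
  all_multilinear (ts ++ ts').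
  by elim: ts => //= t ts IH [? ?] ?; split=> //; exact: IH.
apply: catH; first exact: all_multilinear_flatten.
by split; [exact: letter_multilinear|exact: all_multilinear_flatten].
Qed.

Lemma nested_sum_multilinear (P : forall n, {set {set {set 'I_n.+1}}})
    (H : forall n, {set {set 'I_n.+1}} -> {set 'I_n.+1} -> series B) :
  multilinear (fun s => \sum_(p in P (size s)) nested (H _ p) p s).
Proof.
move=> u v k x y /=.
pose S n s := \sum_(p in P n) nested (H n p) p s.
have E z : S (size (u ++ z :: v)) (u ++ z :: v)
    = S (size (u ++ 0 :: v)) (u ++ z :: v) by rewrite !size_cat.
rewrite -!/(S _ _) !E /S scaler_sumr -big_split /=.
by apply: eq_bigr => p _; exact: nested_multilinear.
Qed.

End Nested.

Section Cumulants.
Variables (K : comNzRingType) (B : algType K).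
Implicit Types F G : seq B -> B.

Let agree m F G := forall t : seq B, (size t <= m)%N -> F t = G t.

Definition is_arg (t : token B) : bool :=
  match t with Comma | Close => true | _ => false end.

Let agree_token m (t t' : token B) : Prop :=
  match t, t' with
  | Coef b, Coef b' => b = b'
  | Open F, Open G | Unary F, Unary G => agree m F G
  | Comma, Comma | Close, Close => True
  | _, _ => False
  end.

Fixpoint agree_string m (ts ts' : seq (token B)) : Prop :=
  match ts, ts' with
  | [::], [::] => True
  | t :: ts, t' :: ts' => agree_token m t t' /\ agree_string m ts ts'
  | _, _ => False
  end.

Fixpoint agree_stack m c (stk stk' : seq (B * (seq B -> B) * seq B)) : Prop :=
  match stk, stk' with
  | [::], [::] => True
  | (a, F, args) :: stk, (a', G, args') :: stk' =>
      [/\ a = a', agree m F G, args = args' & (size args + c <= m)%N]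
      /\ agree_stack m c stk stk'
  | _, _ => False
  end.

Lemma agree_stackW m c c' stk stk' : (c' <= c)%N ->
  agree_stack m c stk stk' -> agree_stack m c' stk stk'.
Proof.
move=> cc'; elim: stk stk' => [|[[a F] args] stk IH] [|[[a' G] args'] stk'] //=.
move=> [[-> FG -> h] hs]; split; last exact: IH.
split=> //; by apply: leq_trans h; rewrite leq_add2l.
Qed.

Lemma read_agree m ts ts' acc stk stk' :
  agree_string m ts ts' -> (count is_arg ts <= m)%N ->
  agree_stack m (count is_arg ts) stk stk' ->
  read acc stk ts = read acc stk' ts'.
Proof.
elim: ts ts' acc stk stk' => [|t ts IH] [|t' ts'] acc stk stk' //=.
  by case: stk stk' => [|[[a F] args] stk] [|[[a' G] args'] stk'].
case: t t' => [b|F|||F] [b'|G|||G] //= [tt' tsts'] //.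
- by rewrite add0n tt' => ? ?; exact: IH.
- rewrite add0n => cm h; apply: IH => //=; split=> //.
- case: stk stk' => [|[[a F] args] stk] [|[[a' G] args'] stk'] //= cm.
  case=> -[-> FG -> h] hs; apply: IH => //=; first by apply: leq_trans cm.
  split; last by apply: agree_stackW hs.
  by split=> //; rewrite size_rcons addSnnS.
- case: stk stk' => [|[[a F] args] stk] [|[[a' G] args'] stk'] //= cm.
  case=> -[-> FG -> h] hs; rewrite FG; last first.
    by rewrite size_rcons; apply: leq_trans h; rewrite addnA addn1 leq_addr.
  apply: IH => //=; first by apply: leq_trans cm.
  by apply: agree_stackW hs.
- by rewrite add0n (tt' [::]) // => ? ?; exact: IH.
Qed.

Lemma string_agree m n F G (p : {set {set 'I_n.+1}}) s : agree m F G ->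
  agree_string m (string (fun=> F) p s) (string (fun=> G) p s).
Proof.
move=> FG.
have letterFG k : agree_token m (letter (fun=> F) p k) (letter (fun=> G) p k).
  by rewrite /letter; case: ifP => //; case: ifP => //; case: ifP.
by split=> //; elim: (enum 'I_n).
Qed.

Lemma letter_min n (H : {set 'I_n} -> seq B -> B) p i :
  is_min (pblock p i) i -> is_arg (letter H p i) = false.
Proof. by move=> imin; rewrite /letter imin; case: ifP. Qed.

Lemma min_exists n (V : {set 'I_n}) : V != set0 ->
  exists2 i, i \in V & is_min V i.
Proof.
case/set0Pn => j jV; case: (arg_minnP (fun i : 'I_n => nat_of_ord i) jV) => i iV h.
by exists i => //; apply/forall_inP.
Qed.

Lemma count_string n (H : {set 'I_n.+1} -> seq B -> B) p s :
  partition p [set: 'I_n.+1] -> p != [set setT] ->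
  (count is_arg (string H p s) < n)%N.
Proof.
move=> pP p1; have [/eqP covp trivp p0] := and3P pP.
have min0 : is_min (pblock p ord0) ord0 by apply/forall_inP.
have [V Vp V0] : exists2 V, V \in p & ord0 \notin V.
  have [V0 V0p V0in] : exists2 V, V \in p & ord0 \in V.
    have: ord0 \in cover p by rewrite covp inE.
    by case/bigcupP => V; exists V.
  have [E|V0T] := eqVneq V0 setT.
    case/eqP: p1; apply/setP => W; rewrite inE; apply/idP/eqP => [Wp|->].
      have W0 : W != set0 by apply: contraNneq p0 => <-.
      case/set0Pn: W0 => w wW.
      by rewrite -E -(def_pblock trivp Wp wW) (def_pblock trivp V0p) // E inE.
    by rewrite -E.
  have : ~~ ([set: 'I_n.+1] \subset V0) by rewrite subTset.
  case/subsetPn => w _ wV0.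
  have: w \in cover p by rewrite covp inE.
  case/bigcupP => W Wp wW; exists W => //.
  apply: contraNN wV0 => W0.
  by rewrite -(def_pblock trivp V0p V0in) (def_pblock trivp Wp W0).
have Vn0 : V != set0 by apply: contraNneq p0 => <-.
have [i iV imin] := min_exists Vn0.
have i0 : ord0 != i by apply: contraNneq V0 => ->.
rewrite /string /= letter_min // add0n.
have [j ij] : exists j, i = lift ord0 j.
  by case: (unliftP ord0 i) i0 => [j ->|->]; [exists j|rewrite eqxx].
rewrite count_flatten -map_comp.
have -> : sumn (map (count is_arg \o (fun i0 : 'I_n =>
      [:: Coef (nth 0 s i0); letter H p (lift ord0 i0)])) (enum 'I_n))
    = count (fun i0 => is_arg (letter H p (lift ord0 i0))) (enum 'I_n).
  by elim: (enum 'I_n) => //= k r ->; rewrite add0n addn0.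
set a := fun _ => _.
rewrite -[X in (_ < X)%N](size_enum_ord n) -(count_predC a).
rewrite -[X in (X < _)%N]addn0 ltn_add2l -has_count.
apply/hasP; exists j; first by rewrite mem_enum.
by rewrite /= /a -ij letter_min // (def_pblock trivp Vp iV).
Qed.

Lemma nested_agree n F G p s :
  partition p [set: 'I_n.+1] -> p != [set setT] ->
  (forall t : seq B, (size t < n)%N -> F t = G t) ->
  mono_nested F p s = mono_nested G p s.
Proof.
move=> pP p1 FG; have := count_string (fun=> F) s pP p1.
case: n p pP p1 FG => // n p pP p1 FG cn.
apply: (@read_agree n) => //.
by apply: string_agree => t tn; exact: FG.
Qed.

Lemma pblock1 n (i : 'I_n) : pblock [set [set: 'I_n]] i = setT.
Proof.
apply: def_pblock; rewrite ?inE //.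
by apply/trivIsetP => U V; rewrite !inE => /eqP-> /eqP->; rewrite eqxx.
Qed.

Lemma nested1 F s :
  mono_nested F [set [set: 'I_(size s).+1]] s = F s.
Proof.
rewrite /mono_nested /nested.
case E : (size s) => [|n].
  rewrite (size0nil E) /string /letter pblock1 cardsT card_ord /=.
  have -> : enum 'I_0 = [::] by apply: size0nil; rewrite size_enum_ord.
  by rewrite /= mul1r.
pose f i := [:: Coef (nth 0 s i); if i == n then Close B else Comma B].
have -> : string (fun=> F) [set [set: 'I_n.+2]] s
    = Open F :: flatten [seq f i | i <- iota 0 n.+1].
  rewrite /string; congr (_ :: _).
    rewrite /letter pblock1 cardsT card_ord /=.
    by rewrite ifT //; apply/forall_inP.
  rewrite -val_enum_ord -map_comp; congr flatten.
  apply: eq_map => i; rewrite /f /=; congr [:: _; _].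
  rewrite /letter pblock1 cardsT card_ord /= ifF; last first.
    by apply/negbTE/forall_inPn; exists ord0; rewrite ?inE.
  case: eqP => [iE|/eqP iE].
    by rewrite ifT //; apply/forall_inP => j _ /=; rewrite /bump /= add1n iE -ltnS.
  rewrite ifF //; apply/negbTE/forall_inPn; exists ord_max; rewrite ?inE //=.
  by rewrite /bump /= add1n ltnS -ltnNge ltn_neqAle iE -ltnS ltn_ord.
have G j k : (j + k = n)%N ->
  read 1 [:: (1, F, take j s)] (flatten [seq f i | i <- iota j k.+1]) = F s.
  elim: k j => [|k IH] j.
    rewrite addn0 => jn; rewrite /= jn eqxx /= !mul1r -take_nth ?E //.
    by rewrite -E take_size.
  move=> jk; have jn : (j == n) = false.
    by apply/negbTE; rewrite -jk -[X in X == _]addn0 eqn_add2l.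
  rewrite -(IH j.+1) ?addSnnS //.
  pose R := flatten [seq f i | i <- iota j.+1 k.+1].
  have -> : flatten [seq f i | i <- iota j k.+2] = Coef s`_j :: Comma B :: R.
    by rewrite /= /f jn.
  rewrite -/R; move: R => R.
  by rewrite /= mul1r -take_nth // E -jk addnS ltnS ltnW // ltnS leq_addr.
by have := G 0%N n (add0n n); rewrite take0.
Qed.

Section Transform.
Variable P : forall n, {set {set {set 'I_n.+1}}}.
Hypothesis P_partition : forall n p, p \in P n -> partition p [set: 'I_n.+1].
Hypothesis P1 : forall n, [set setT] \in P n.

Definition nested_sum (F : series B) : series B :=
  Series (nested_sum_multilinear P (fun _ _ _ => F)).

Let lower (F : series B) (s : seq B) : B :=
  \sum_(p in P (size s) | p != [set setT]) mono_nested F p s.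

Let nested_sumE (F : series B) s : nested_sum F s = F s + lower F s.
Proof.
rewrite -[LHS]/(\sum_(p in P (size s)) mono_nested F p s).
by rewrite (bigD1 [set setT]) ?P1 // nested1.
Qed.

Let lower_agree (F G : series B) s :
  (forall t : seq B, (size t < size s)%N -> F t = G t) -> lower F s = lower G s.
Proof.
move=> FG; apply: eq_bigr => p /andP[pP p1]; apply: nested_agree => //.
exact: P_partition.
Qed.

Let step_subproof (M F : series B) : multilinear (fun s => M s - lower F s).
Proof.
have E s : M s - lower F s = M s - nested_sum F s + F s.
  by rewrite nested_sumE opprD addrA addrAC subrK.
have alg (k : K) (p q r p' q' r' : B) : (k *: p + p') - (k *: q + q') + (k *: r + r')
    = k *: (p - q + r) + (p' - q' + r').
  rewrite scalerDr scalerBr opprD.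
  have -> : k *: p + p' + (- (k *: q) - q') = (k *: p - k *: q) + (p' - q').
    by rewrite addrACA.
  by rewrite addrACA.
by move=> u v k x y; rewrite !E !sfun_multilinear alg.
Qed.

Let step (M F : series B) := Series (step_subproof M F).

Lemma nested_sum_bij (M : series B) : exists! F : series B, nested_sum F = M.
Proof.
pose z : series B := M.
pose it k := iter k (step M) z.
have itS k t : (size t < k)%N -> it k.+1 t = it k t.
  elim: k t => // k IH t tk; rewrite /it !iterS -!/(it _) /=; congr (_ - _).
  by apply: lower_agree => t' t't; apply: IH; exact: leq_trans t't tk.
have itE k t : (size t < k)%N -> it k t = it (size t).+1 t.
  elim: k => // k IH; rewrite ltnS leq_eqVlt => /predU1P[->//|tk].
  by rewrite itS // IH.
have Flin : multilinear (fun s => it (size s).+1 s).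
  move=> u v k x y.
  have sE w : size (u ++ w :: v) = size (u ++ 0 :: v) by rewrite !size_cat.
  by rewrite (sE x) (sE y) (sE (_ + _)) sfun_multilinear.
exists (Series Flin); split.
  apply: seriesP => s; rewrite nested_sumE.
  rewrite (@lower_agree _ (it (size s))) => [|t ts]; first exact: subrK.
  by rewrite (itE (size s)).
move=> G GM; apply: seriesP => s; rewrite -[LHS]/(it (size s).+1 s).
elim: {s}_.+1 {-2}s (ltnSn (size s)) => // n IH s sn.
rewrite -[LHS]/(M s - lower (it (size s)) s) -GM nested_sumE.
rewrite (@lower_agree _ G) ?addrK // => t ts.
by rewrite (itE (size s)) // IH //; exact: leq_trans ts sn.
Qed.

End Transform.
End Cumulants.

Lemma partition1 n : partition [set [set: 'I_n.+1]] [set: 'I_n.+1].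
Proof.
apply/and3P; split.
- by rewrite /cover big_set1.
- by apply/trivIsetP => U V; rewrite !inE => /eqP-> /eqP->; rewrite eqxx.
- by rewrite inE eq_sym; apply/set0Pn; exists ord0; rewrite inE.
Qed.

Lemma NC_partition n p : p \in NC n.+1 -> partition p [set: 'I_n.+1].
Proof. by rewrite inE => /andP[]. Qed.

Lemma NC1 n : [set setT] \in NC n.+1.
Proof.
rewrite inE /noncrossing partition1 /=.
apply/forall_inP => V; rewrite inE => /eqP->.
apply/forall_inP => W; rewrite inE => /eqP->.
apply/forall_inP => i _; apply/forall_inP => j _.
by apply/forall_inP => k _; apply/forall_inP => l _; rewrite eqxx implybT.
Qed.

Lemma IntP_partition n p : p \in IntP n.+1 -> partition p [set: 'I_n.+1].
Proof. by rewrite inE => /andP[]. Qed.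

Lemma IntP1 n : [set setT] \in IntP n.+1.
Proof.
rewrite inE partition1; apply/forall_inP => V; rewrite inE => /eqP->.
apply/forall_inP => i _; apply/forall_inP => j _.
by apply/forallP => k; rewrite inE implybT.
Qed.

Section Transforms.
Variables (K : comNzRingType) (B : algType K).
Implicit Types (mu nu : distr B) (F : series B) (alpha : {linear B -> B}).

Definition is_Rtransform mu F : Prop := forall s,
  moment_series mu s = \sum_(p in NC (size s).+1) mono_nested F p s.

Definition is_Btransform mu F : Prop := forall s,
  moment_series mu s = \sum_(p in IntP (size s).+1) mono_nested F p s.

Let transform_unique (P : forall n, {set {set {set 'I_n.+1}}})
    (Pp : forall n p, p \in P n -> partition p [set: 'I_n.+1])
    (P1 : forall n, [set setT] \in P n) mu :
  exists! F, forall s,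
    moment_series mu s = \sum_(p in P (size s)) mono_nested F p s.
Proof.
have [F [FM Funiq]] := nested_sum_bij Pp P1 (moment_series mu).
exists F; split=> [s|G Gmu]; first by rewrite -FM.
by apply: Funiq; apply: seriesP => s; rewrite Gmu.
Qed.

Lemma Rtransform_unique mu : exists! F, is_Rtransform mu F.
Proof. exact: (transform_unique NC_partition NC1). Qed.

Lemma Btransform_unique mu : exists! F, is_Btransform mu F.
Proof. exact: (transform_unique IntP_partition IntP1). Qed.

Definition Rtransform mu : series B := sval (cid (Rtransform_unique mu)).
Definition Btransform mu : series B := sval (cid (Btransform_unique mu)).

Lemma RtransformP mu : is_Rtransform mu (Rtransform mu).
Proof. by have [] := svalP (cid (Rtransform_unique mu)). Qed.

Lemma BtransformP mu : is_Btransform mu (Btransform mu).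
Proof. by have [] := svalP (cid (Btransform_unique mu)). Qed.

Lemma Rtransform_eq mu F : is_Rtransform mu F -> Rtransform mu = F.
Proof. by have [_ h] := svalP (cid (Rtransform_unique mu)); exact: h. Qed.

Lemma Btransform_eq mu F : is_Btransform mu F -> Btransform mu = F.
Proof. by have [_ h] := svalP (cid (Btransform_unique mu)); exact: h. Qed.

Lemma Rtransform_bij F : exists! mu, Rtransform mu = F.
Proof.
have [mu [muF mu_uniq]] :=
  moment_series_bij (nested_sum (fun n => NC n.+1) F).
exists mu; split; first by apply: Rtransform_eq => s; rewrite muF.
move=> nu nuF; apply: mu_uniq; apply: seriesP => s.
by rewrite (RtransformP nu) nuF.
Qed.

Lemma Btransform_bij F : exists! mu, Btransform mu = F.
Proof.
have [mu [muF mu_uniq]] :=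
  moment_series_bij (nested_sum (fun n => IntP n.+1) F).
exists mu; split; first by apply: Btransform_eq => s; rewrite muF.
move=> nu nuF; apply: mu_uniq; apply: seriesP => s.
by rewrite (BtransformP nu) nuF.
Qed.

Definition Rtransform_inv F : distr B := sval (cid (Rtransform_bij F)).
Definition Btransform_inv F : distr B := sval (cid (Btransform_bij F)).

Lemma Rtransform_invK : cancel Rtransform_inv Rtransform.
Proof. by move=> F; have [] := svalP (cid (Rtransform_bij F)). Qed.

Lemma Btransform_invK : cancel Btransform_inv Btransform.
Proof. by move=> F; have [] := svalP (cid (Btransform_bij F)). Qed.

Definition boxplus_pow mu alpha : distr B :=
  Rtransform_inv (comp_series alpha (Rtransform mu)).

Definition uplus_pow mu alpha : distr B :=
  Btransform_inv (comp_series alpha (Btransform mu)).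

Definition RBhat_fun alpha F (s : seq B) : B :=
  \sum_(p in NC (size s).+1 | ll1 p)
     coloured_nested F (comp_series alpha F) p (outer_colouring p) s.

Lemma RBhat_subproof alpha F : multilinear (RBhat_fun alpha F).
Proof.
pose H n (p : {set {set 'I_n.+1}}) V : series B :=
  if outer_colouring p V is colour1 then F else comp_series alpha F.
have := nested_sum_multilinear (fun n => [set p in NC n.+1 | ll1 p]) H.
congr multilinear; apply: funext => s; rewrite /RBhat_fun big_set /=.
apply: eq_bigr => p _; rewrite /coloured_nested /H; congr (nested _ p s).
by apply: funext => V; case: outer_colouring.
Qed.

Definition RBhat alpha F : series B := Series (RBhat_subproof alpha F).

Definition BBmap alpha mu : distr B :=
  Rtransform_inv (RBhat alpha (Rtransform mu)).

End Transforms.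

(* Main.v *)
Require Import Defs.
From mathcomp Require Import all_boot all_order all_algebra.
From mathcomp Require Import complex reals boolp zify.

(** All series are read as functions on words over B, and each sum over
    partitions is turned into an identity between such functions.

    Write f g for the concatenation product (sum over the cuts of a word in
    two), and f o A for the substitution that cuts a word into nonempty chunks
    and feeds the values of A on the chunks to f.  Let iota be the series that
    is the identity on words of length one and 0 elsewhere.  For a series F let
    A_F be the series of word moments,
      A_F(b_1, ..., b_m) = b_1 M(b_2, ..., b_{m-1}) b_m,
    where M is the moment series with R-transform F.  Splitting a non-crossing
    partition at its outer blocks gives the fixed point equation
      A_F = iota + iota (F o A_F) A_F,
    which determines A_F, and the same splitting identifies the sums over
    partitions with the first and last points in one block: the B-transform of
    the distribution with R-transform F is F o A_F, and the series
    RBhat alpha F is F o A_{alpha F}.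

    The theorem then follows from the semigroup law
      A_{alpha F} o A_G = A_{(1 + alpha) F},   with G = F o A_{alpha F},
    which holds because the left-hand side satisfies the fixed point equation
    of the right-hand side ([words_semigroup]).  Combinatorially it recolours
    the blocks of a partition with two colours and groups each block of the
    second colour with the closest block of the first colour around it.  Indeed
    the B-transform of BBmap alpha mu is
      G o A_G = F o A_{alpha F} o A_G = F o A_{(1 + alpha) F},
    and applying 1 + alpha gives ((1 + alpha) F) o A_{(1 + alpha) F}, the
    B-transform of the boxplus power.

    The passage from partitions to words goes through the well-formed strings
    of parentheses: a non-crossing partition is determined by recording for
    each point whether it is the minimum and whether it is the maximum of its
    block, and every balanced record arises ([perm_partition_words]).  As a
    partition is evaluated by a stack machine that reads this record from left
    to right, the sum over partitions becomes a sum over records, which unfolds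
    letter by letter ([read_sum_cons]) and decomposes at the first return of
    the stack ([read_sum_frame]). *)

Set Implicit Arguments.
Unset Strict Implicit.
Unset Printing Implicit Defensive.

Import GRing.Theory.
Local Open Scope ring_scope.

(** * Cutting words *)

Section Cuts.
Variables (T : Type) (V : nmodType).
Implicit Types (b : T) (s : seq T).

Fixpoint cuts s : seq (seq T * seq T) :=
  ([::], s) :: if s is b :: s' then [seq (b :: x.1, x.2) | x <- cuts s'] else [::].

Fixpoint chunkings s : seq (seq (seq T)) :=
  if s is b :: s' then
    flatten [seq ([:: b] :: ps) :: (if ps is p :: ps' then [:: (b :: p) :: ps'] else [::])
            | ps <- chunkings s']
  else [:: [::]].

Lemma cuts_cons b s :
  cuts (b :: s) = ([::], b :: s) :: [seq (b :: x.1, x.2) | x <- cuts s].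
Proof. by []. Qed.

Lemma sum_cuts_nil (h : seq T -> seq T -> V) :
  \sum_(x <- cuts [::]) h x.1 x.2 = h [::] [::].
Proof. exact: big_seq1. Qed.

Lemma sum_cuts_cons (h : seq T -> seq T -> V) b s :
  \sum_(x <- cuts (b :: s)) h x.1 x.2
  = h [::] (b :: s) + \sum_(x <- cuts s) h (b :: x.1) x.2.
Proof. by rewrite cuts_cons big_cons big_map. Qed.

Lemma sum_chunkings_nil (h : seq (seq T) -> V) :
  \sum_(ps <- chunkings [::]) h ps = h [::].
Proof. exact: big_seq1. Qed.

(** Cutting a word in three does not depend on which cut is made first. *)
Lemma sum_cuts_assoc (h : seq T -> seq T -> seq T -> V) s :
  \sum_(x <- cuts s) \sum_(y <- cuts x.1) h y.1 y.2 x.2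
  = \sum_(x <- cuts s) \sum_(y <- cuts x.2) h x.1 y.1 y.2.
Proof.
elim: s h => [|b s IH] h.
  rewrite (sum_cuts_nil (fun u v => \sum_(y <- cuts u) h y.1 y.2 v)).
  rewrite (sum_cuts_nil (fun u v => \sum_(y <- cuts v) h u y.1 y.2)).
  by rewrite (sum_cuts_nil (fun u v => h u v [::])) (sum_cuts_nil (h [::])).
rewrite (sum_cuts_cons (fun u v => \sum_(y <- cuts u) h y.1 y.2 v)).
rewrite (sum_cuts_cons (fun u v => \sum_(y <- cuts v) h u y.1 y.2)).
rewrite -(IH (fun u => h (b :: u))) (sum_cuts_nil (fun u v => h u v (b :: s))).
rewrite (sum_cuts_cons (h [::])) -addrA -big_split; congr (_ + _).
by apply: eq_bigr => x _; rewrite (sum_cuts_cons (fun u v => h u v x.2)).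
Qed.

Lemma sum_cuts_left_nil (h : seq T -> V) s :
  \sum_(x <- cuts s) (if nilp x.1 then h x.2 else 0) = h s.
Proof.
case: s => [|b s]; first exact: (sum_cuts_nil (fun u v => if nilp u then h v else 0)).
rewrite (sum_cuts_cons (fun u v => if nilp u then h v else 0)) /=.
by rewrite big1 ?addr0.
Qed.

Lemma sum_cuts_right_nil (h : seq T -> V) s :
  \sum_(x <- cuts s) (if nilp x.2 then h x.1 else 0) = h s.
Proof.
elim: s h => [|b s IH] h.
  exact: (sum_cuts_nil (fun u v => if nilp v then h u else 0)).
by rewrite (sum_cuts_cons (fun u v => if nilp v then h u else 0)) /= add0r
           (IH (fun u => h (b :: u))).
Qed.

Lemma eq_sum_cuts (h g : seq T -> seq T -> V) s :
  (forall u v, (size u <= size s)%N -> (size v <= size s)%N -> h u v = g u v) ->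
  \sum_(x <- cuts s) h x.1 x.2 = \sum_(x <- cuts s) g x.1 x.2.
Proof.
elim: s h g => [|b s IH] h g hg; first by rewrite !sum_cuts_nil hg.
rewrite !sum_cuts_cons hg //; congr (_ + _).
apply: (IH (fun u => h (b :: u)) (fun u => g (b :: u))) => u v us vs.
by apply: hg; rewrite // ltnW.
Qed.

(** The recursion behind every later induction: choose the first chunk, which
    contains the first letter, and then chunk what remains. *)
Lemma sum_chunkings_cons (h : seq (seq T) -> V) b s :
  \sum_(ps <- chunkings (b :: s)) h ps
  = \sum_(x <- cuts s) \sum_(ps <- chunkings x.2) h ((b :: x.1) :: ps).
Proof.
elim: s b h => [|c s IH] b h.
  rewrite (sum_cuts_nil (fun u v => \sum_(ps <- chunkings v) h ((b :: u) :: ps))).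
  by rewrite /= !big_seq1.
rewrite (sum_cuts_cons (fun u v => \sum_(ps <- chunkings v) h ((b :: u) :: ps))).
transitivity (\sum_(ps <- chunkings (c :: s))
    (h ([:: b] :: ps) + if ps is p :: ps' then h ((b :: p) :: ps') else 0)).
  rewrite [chunkings (b :: _)]/= -/(chunkings (c :: s)).
  elim: (chunkings (c :: s)) => [|ps r IHr]; first by rewrite !big_nil.
  rewrite [RHS]big_cons -IHr.
  by case: ps => [|p ps] /=; rewrite !big_cons ?addr0 ?addrA.
rewrite big_split /= (IH c (fun ps => h ([:: b] :: ps))).
rewrite (IH c (fun ps => if ps is p :: ps' then h ((b :: p) :: ps') else 0)).
by [].
Qed.

Lemma eq_sum_chunkings (h g : seq (seq T) -> V) s :
  (forall ps, all (fun p => (size p <= size s)%N) ps -> h ps = g ps) ->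
  \sum_(ps <- chunkings s) h ps = \sum_(ps <- chunkings s) g ps.
Proof.
have [n] := ubnP (size s); elim: n s h g => // n IH [|b s] h g /= sn hg.
  by rewrite !sum_chunkings_nil hg.
rewrite !sum_chunkings_cons.
apply: (eq_sum_cuts (h := fun u v => \sum_(ps <- chunkings v) h ((b :: u) :: ps))
   (g := fun u v => \sum_(ps <- chunkings v) g ((b :: u) :: ps))) => u v us vs.
apply: IH => [|ps psP]; first lia.
apply: hg => /=; apply/andP; split=> //.
by apply: sub_all psP => p; lia.
Qed.

End Cuts.

(** A cut of the list of chunks is a cut of the word at a boundary between two
    chunks; this is why substitution is multiplicative. *)
Lemma sum_chunkings_cuts (T : Type) (V : nmodType)
    (h : seq (seq T) -> seq (seq T) -> V) s :
  \sum_(ps <- chunkings s) \sum_(y <- cuts ps) h y.1 y.2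
  = \sum_(x <- cuts s) \sum_(p <- chunkings x.1) \sum_(q <- chunkings x.2) h p q.
Proof.
have [n] := ubnP (size s); elim: n s h => // n IH [|b s] h /= sn.
  rewrite sum_chunkings_nil sum_cuts_nil.
  rewrite (sum_cuts_nil (fun u v => \sum_(p <- chunkings u) \sum_(q <- chunkings v) h p q)).
  by rewrite !sum_chunkings_nil.
rewrite sum_chunkings_cons.
rewrite (sum_cuts_cons (fun u v => \sum_(p <- chunkings u) \sum_(q <- chunkings v) h p q)).
rewrite sum_chunkings_nil sum_chunkings_cons.
transitivity (\sum_(x <- cuts s) \sum_(ps <- chunkings x.2) h [::] ((b :: x.1) :: ps)
  + \sum_(x <- cuts s) \sum_(y <- cuts x.2) \sum_(p <- chunkings y.1)
      \sum_(q <- chunkings y.2) h ((b :: x.1) :: p) q).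
  rewrite -big_split.
  apply: (eq_sum_cuts (h := fun u v => \sum_(ps <- chunkings v)
      \sum_(y <- cuts ((b :: u) :: ps)) h y.1 y.2) (g := fun u v =>
      \sum_(ps <- chunkings v) h [::] ((b :: u) :: ps) +
      \sum_(y <- cuts v) \sum_(p <- chunkings y.1)
      \sum_(q <- chunkings y.2) h ((b :: u) :: p) q)) => u v us vs.
  rewrite -(IH v (fun p => h ((b :: u) :: p))); last lia.
  by rewrite -big_split; apply: eq_bigr => ps _; rewrite sum_cuts_cons.
congr (_ + _).
rewrite -(sum_cuts_assoc (fun u v w => \sum_(p <- chunkings v)
      \sum_(q <- chunkings w) h ((b :: u) :: p) q)).
by apply: eq_bigr => x _; rewrite sum_chunkings_cons.
Qed.

Lemma cuts_map (T U : Type) (f : T -> U) s :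
  cuts (map f s) = [seq (map f x.1, map f x.2) | x <- cuts s].
Proof.
by elim: s => //= b s ->; rewrite -!map_comp.
Qed.

(** * Concatenation product, substitution and word moments *)

Section Substitution.
Variables (K : comNzRingType) (B : algType K).
Implicit Types (f g h A : seq B -> B) (s : seq B).

Definition conv f g s : B := \sum_(x <- cuts s) f x.1 * g x.2.

Definition subst f A s : B := \sum_(ps <- chunkings s) f (map A ps).

Definition single s : B := if s is [:: b] then b else 0.

Lemma convA f g h : conv f (conv g h) = conv (conv f g) h.
Proof.
apply: funext => s; rewrite /conv.
transitivity (\sum_(x <- cuts s) \sum_(y <- cuts x.2) f x.1 * (g y.1 * h y.2)).
  by apply: eq_bigr => x _; rewrite mulr_sumr.
rewrite -(sum_cuts_assoc (fun u v w => f u * (g v * h w))).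
by apply: eq_bigr => x _; rewrite mulr_suml; apply: eq_bigr => y _; rewrite mulrA.
Qed.

Lemma convDr f g h : conv f (g \+ h) = conv f g \+ conv f h.
Proof.
by apply: funext => s; rewrite /conv /= -big_split; apply: eq_bigr => x _; rewrite mulrDr.
Qed.

Lemma convDl f g h : conv (f \+ g) h = conv f h \+ conv g h.
Proof.
by apply: funext => s; rewrite /conv /= -big_split; apply: eq_bigr => x _; rewrite mulrDl.
Qed.

Lemma conv_single_nil g : conv single g [::] = 0.
Proof. by rewrite /conv (sum_cuts_nil (fun u v => single u * g v)) mul0r. Qed.

Lemma conv_single_cons g b s : conv single g (b :: s) = b * g s.
Proof.
rewrite /conv (sum_cuts_cons (fun u v => single u * g v)) mul0r add0r.
rewrite -(sum_cuts_left_nil (fun v => b * g v)).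
by apply: eq_bigr => -[[|c u] v] _ //=; rewrite mul0r.
Qed.

Lemma subst_nil f A : subst f A [::] = f [::].
Proof. exact: sum_chunkings_nil. Qed.

Lemma subst_cons f A b s :
  subst f A (b :: s) = \sum_(x <- cuts s) subst (fun w => f (A (b :: x.1) :: w)) A x.2.
Proof. by rewrite /subst sum_chunkings_cons. Qed.

Lemma substD f g A : subst (f \+ g) A = subst f A \+ subst g A.
Proof. by apply: funext => s; rewrite /subst /= -big_split. Qed.

Lemma subst_additive (alpha : {additive B -> B}) f A :
  subst (alpha \o f) A = alpha \o subst f A.
Proof. by apply: funext => s; rewrite /subst /= raddf_sum. Qed.

Lemma subst_single A : A [::] = 0 -> subst single A = A.
Proof.
move=> A0; apply: funext => -[|b s]; first by rewrite subst_nil A0.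
rewrite subst_cons -(sum_cuts_right_nil (fun u => A (b :: u))).
apply: eq_bigr => -[u [|c v]] _ /=; first by rewrite subst_nil.
by rewrite subst_cons big1 // => x _; rewrite /subst big1.
Qed.

Lemma subst_conv f g A : subst (conv f g) A = conv (subst f A) (subst g A).
Proof.
apply: funext => s; rewrite /subst /conv.
transitivity (\sum_(ps <- chunkings s)
    \sum_(y <- cuts ps) f (map A y.1) * g (map A y.2)).
  by apply: eq_bigr => ps _; rewrite cuts_map big_map.
rewrite (sum_chunkings_cuts (fun p q => f (map A p) * g (map A q))).
apply: eq_bigr => x _; rewrite mulr_suml.
by apply: eq_bigr => p _; rewrite mulr_sumr.
Qed.

Lemma multilinear_bigsum (V : lmodType K) (F : seq B -> V) u v (I : Type) (r : seq I) (a : I -> B) :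
  multilinear F -> F (u ++ (\sum_(i <- r) a i) :: v) = \sum_(i <- r) F (u ++ a i :: v).
Proof.
move=> Flin; apply: (big_morph (fun x => F (u ++ x :: v))).
- by move=> x y; exact: multilinearD.
- exact: multilinear0.
Qed.

Lemma multilinear_cat u f : multilinear f -> multilinear (fun w => f (u ++ w)).
Proof. by move=> flin v w k x y; rewrite !catA flin. Qed.

Lemma subst_eq f A A' s :
  (forall t, (size t <= size s)%N -> A t = A' t) -> subst f A s = subst f A' s.
Proof.
move=> AA'; apply: eq_sum_chunkings => ps /allP psP.
by congr f; apply/eq_in_map => p /psP; exact: AA'.
Qed.

(** Both sides sum over a chunking of the word and a coarser chunking of it.
    On the right [f] receives sums over the refinements of each coarse chunk,
    and multilinearity expands them. *)
Lemma subst_assoc f A A' : multilinear f ->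
  subst (subst f A) A' = subst f (subst A A').
Proof.
move=> flin; apply: funext => s; have [n] := ubnP (size s).
elim: n s f flin => // n IH [|b s] f flin /= sn; first by rewrite !subst_nil.
rewrite !subst_cons.
pose h c t u : B :=
  \sum_(p <- chunkings t) subst (fun w => f (A (c :: map A' p) :: w)) (subst A A') u.
transitivity (\sum_(x <- cuts s) \sum_(y <- cuts x.2) h (A' (b :: x.1)) y.1 y.2).
  apply: (eq_sum_cuts (h := fun u v => subst (fun w => subst f A (A' (b :: u) :: w)) A' v)
     (g := fun u v => \sum_(y <- cuts v) h (A' (b :: u)) y.1 y.2)) => u v us vs.
  pose k p q := subst (fun w => f (A (A' (b :: u) :: map A' p) :: w)) A (map A' q).
  transitivity (\sum_(ps <- chunkings v) \sum_(y <- cuts ps) k y.1 y.2).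
    by apply: eq_bigr => ps _; rewrite subst_cons cuts_map big_map.
  rewrite sum_chunkings_cuts.
  apply: (eq_sum_cuts (h := fun u v => \sum_(p <- chunkings u) \sum_(q <- chunkings v) k p q)
     (g := h (A' (b :: u)))) => v1 v2 v1s v2s.
  apply: eq_bigr => p _; rewrite -IH //; last lia.
  exact: (@multilinear_cat [:: _] f).
rewrite -(sum_cuts_assoc (fun u => h (A' (b :: u)))).
apply: eq_bigr => x _; rewrite /h.
have -> : subst A A' (b :: x.1) = \sum_(y <- cuts x.1) \sum_(p <- chunkings y.2)
    A (A' (b :: y.1) :: map A' p) by exact: sum_chunkings_cons.
rewrite [RHS]/subst.
under [RHS]eq_bigr do rewrite (multilinear_bigsum [::]) //.
rewrite exchange_big; apply: eq_bigr => y _.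
under [RHS]eq_bigr do rewrite (multilinear_bigsum [::]) //.
by rewrite exchange_big.
Qed.

(** An operator whose output on a word only depends on its input on shorter
    words has a unique fixed point. *)
Section Contraction.
Variable Phi : (seq B -> B) -> seq B -> B.
Hypothesis Phi_contract : forall A A' s,
  (forall t, (size t < size s)%N -> A t = A' t) -> Phi A s = Phi A' s.

Lemma contract_exists : exists A, A = Phi A.
Proof.
(* The k-th iterate is already correct on words shorter than k. *)
pose it k := iter k Phi (fun=> 0).
have itS k s : (size s < k)%N -> it k.+1 s = it k s.
  elim: k s => // k IH s sk; apply: Phi_contract => t ts; apply: IH; lia.
have itE k s : (size s < k)%N -> it k s = it (size s).+1 s.
  elim: k => // k IH; rewrite ltnS leq_eqVlt => /predU1P[->//|sk].
  by rewrite itS // IH.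
exists (fun s => it (size s).+1 s); apply: funext => s.
by apply: Phi_contract => t; exact: itE.
Qed.

Lemma contract_unique A A' : A = Phi A -> A' = Phi A' -> A = A'.
Proof.
move=> AE A'E; apply: funext => s; have [n] := ubnP (size s).
elim: n s => // n IH s sn; rewrite AE A'E.
by apply: Phi_contract => t ts; apply: IH; lia.
Qed.

End Contraction.

(** The operator A |-> iota + iota (f o A) A, whose fixed point collects the word
    moments.  The flag [e] switches the second term off: this is the case
    where no block may be nested inside another one, and then the fixed point
    is iota. *)
Definition words_step (e : bool) f A s : B :=
  single s + (if e then conv single (conv (subst f A) A) s else 0).

Lemma words_step_contract e f A A' s :
  (forall t, (size t < size s)%N -> A t = A' t) ->
  words_step e f A s = words_step e f A' s.
Proof.
move=> AA'; rewrite /words_step; congr (_ + _); case: e => //.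
case: s AA' => [|b s] AA'; first by rewrite !conv_single_nil.
rewrite !conv_single_cons; congr (_ * _).
apply: (eq_sum_cuts (h := fun u v => subst f A u * A v)
  (g := fun u v => subst f A' u * A' v)) => u v us vs.
rewrite (@subst_eq f A A') ?AA' //= ?ltnS //.
by move=> t tu; apply: AA'; rewrite /= ltnS; apply: leq_trans us.
Qed.

Lemma words_nil e f A : A = words_step e f A -> A [::] = 0.
Proof. by move->; rewrite /words_step conv_single_nil add0r; case: e. Qed.

(** With phi = P o Q, x = f o phi and y = g o phi, substituting Q in the equation
    of P gives phi = Q + Q y phi, and Q = iota + iota x Q.  Expanding Q in the
    former by the latter gives phi = iota + iota (x + y) phi, which is the
    equation of W. *)
Lemma words_semigroup f g P Q W : multilinear f -> multilinear g ->
  P = words_step true g P ->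
  Q = words_step true (subst f P) Q ->
  W = words_step true (f \+ g) W ->
  subst P Q = W.
Proof.
move=> flin glin PE QE WE.
pose phi := subst P Q.
have phiE : phi = Q \+ conv Q (conv (subst g phi) phi).
  rewrite {1}/phi {1}PE -[words_step _ _ _]/(single \+ conv single (conv (subst g P) P)).
  by rewrite substD !subst_conv subst_single ?(words_nil QE) // subst_assoc.
have QE' : Q = single \+ conv single (conv (subst f phi) Q).
  by rewrite /phi -subst_assoc.
apply: (contract_unique (@words_step_contract true (f \+ g)) _ WE).
rewrite -/phi.
have -> : words_step true (f \+ g) phi
  = single \+ conv single (conv (subst f phi \+ subst g phi) phi).
  by rewrite -substD.
move: (subst f phi) (subst g phi) phiE QE' => x y phiE QE'.
have QyE : conv Q (conv y phi)
    = conv single (conv y phi) \+ conv single (conv x (conv Q (conv y phi))).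
  by rewrite {1}QE' convDl !convA.
have xE : conv x phi = conv x Q \+ conv x (conv Q (conv y phi)).
  by rewrite {1}phiE convDr.
rewrite convDl convDr xE convDr {1}phiE {1}QyE {1}QE'.
by apply: funext => s /=; rewrite -!addrA; congr (_ + (_ + _)); rewrite addrC.
Qed.

End Substitution.

(** * First-return decomposition of the stack machine *)

(** What a point of a partition knows about its block: whether it is its minimum,
    and whether it is its maximum.  Both hold for a singleton. *)
Definition slot : Type := bool * bool.

Definition slots : seq slot :=
  [:: (true, true); (true, false); (false, false); (false, true)].

Fixpoint slot_words n : seq (seq slot) :=
  if n is m.+1 then [seq x :: w | x <- slots, w <- slot_words m] else [:: [::]].

Definition next_depth d (x : slot) : nat :=
  if x.1 then (if x.2 then d else d.+1) else (if x.2 then d.-1 else d).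

(** A word of slots that can be read from depth [d] and returns to depth 0.  The
    flags [e0] and [e1] tell whether a block may begin at depth 0 and at
    positive depth.  All non-crossing partitions are described by
    [e0 = e1 = true], interval partitions by [e1 = false]; with [e0 = false]
    nothing may follow once the current outer block is closed. *)
Fixpoint balanced (e0 e1 : bool) d (w : seq slot) : bool :=
  if w is x :: w' then
    (if x.1 then (if d is 0 then e0 else e1) else (0 < d)%N)
      && balanced e0 e1 (next_depth d x) w'
  else d == 0%N.

Section Reading.
Variables (K : comNzRingType) (B : algType K).
Implicit Types (F : seq B -> B) (acc b : B) (bs : seq B).
Implicit Types (stk : seq (B * (seq B -> B) * seq B)).

Definition slot_token F (x : slot) : token B :=
  if x.1 then (if x.2 then Unary F else Open F)
  else (if x.2 then Close B else Comma B).

Fixpoint weave F bs (w : seq slot) : seq (token B) :=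
  match bs, w with
  | b :: bs', x :: w' => Coef b :: slot_token F x :: weave F bs' w'
  | _, _ => [::]
  end.

(** The total value of all admissible completions of a string read so far into
    the state [(acc, stk)], when the coefficients [bs] are still to come. *)
Definition read_sum e0 e1 F acc stk bs : B :=
  \sum_(w <- slot_words (size bs) | balanced e0 e1 (size stk) w) read acc stk (weave F bs w).

Lemma read_sum_nil e0 e1 F acc stk :
  read_sum e0 e1 F acc stk [::] = if stk is [::] then acc else 0.
Proof.
rewrite /read_sum /= big_cons big_nil /=.
by case: stk => [|fr stk]; rewrite /= ?addr0.
Qed.

(** One step of the machine: the next slot begins a block (a singleton, or a new
    frame) or continues or closes the block on top of the stack. *)
Lemma read_sum_cons e0 e1 F acc stk b bs :
  read_sum e0 e1 F acc stk (b :: bs)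
  = (if (if stk is [::] then e0 else e1)
     then read_sum e0 e1 F (acc * b * F [::]) stk bs
          + read_sum e0 e1 F 1 ((acc * b, F, [::]) :: stk) bs
     else 0)
  + (if stk is (a, G, args) :: stk' then
       read_sum e0 e1 F 1 ((a, G, rcons args (acc * b)) :: stk') bs
       + read_sum e0 e1 F (a * G (rcons args (acc * b))) stk' bs
     else 0).
Proof.
rewrite /read_sum /= cats0 !big_cat !big_map /=.
case: stk => [|[[a G] args] stk] /=.
  rewrite !big_pred0_eq addr0; case: e0 => /=; first by rewrite !addr0.
  by rewrite !big_pred0_eq !addr0.
by case: e1 => /=; rewrite ?big_pred0_eq ?add0r ?addrA.
Qed.

Lemma all_multilinear_weave F bs w : multilinear F -> all_multilinear (weave F bs w).
Proof.
move=> Flin; elim: bs w => [|b bs IH] [|x w] //=.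
by split=> //; split=> //; rewrite /slot_token; case: ifP => _; case: ifP.
Qed.

Section Additivity.
Variables (e0 e1 : bool) (F : seq B -> B).
Hypothesis Flin : multilinear F.

Lemma read_sum_linear stk bs :
  stk_multilinear stk -> linear (fun x => read_sum e0 e1 F x stk bs).
Proof.
move=> sl k x y; rewrite /read_sum scaler_sumr -big_split.
apply: eq_bigr => w _.
by have [h _ _] := read_linear (all_multilinear_weave bs w Flin); rewrite h.
Qed.

Lemma read_sum_bigsum stk bs (I : Type) (r : seq I) (a : I -> B) :
  stk_multilinear stk ->
  read_sum e0 e1 F (\sum_(i <- r) a i) stk bs
  = \sum_(i <- r) read_sum e0 e1 F (a i) stk bs.
Proof.
move=> sl; pose f x := read_sum e0 e1 F x stk bs.
have flin : linear f by exact: read_sum_linear.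
have f0 : f 0 = 0 by have := flin (-1) 0 0; rewrite scaler0 addr0 scaleN1r addNr.
apply: (big_morph f) => // x y.
by have := flin 1 x y; rewrite !scale1r.
Qed.

Variable A : seq B -> B.
Hypothesis AE : A = words_step e1 F A.

(** As [A] vanishes on the empty word, the first chunk may be allowed to be
    empty; the sums of the first-return decomposition have this form. *)
Lemma subst_cuts f s : multilinear f ->
  subst f A s = (if nilp s then f [::] else 0)
    + \sum_(y <- cuts s) subst (fun w => f (A y.1 :: w)) A y.2.
Proof.
have A0 := words_nil AE; move=> flin.
have f0 t : subst (fun w => f (A [::] :: w)) A t = 0.
  by rewrite /subst big1 // => ps _; rewrite A0 (multilinear0 flin [::]).
case: s => [|b s].
  by rewrite subst_nil (sum_cuts_nil (fun u v => subst (fun w => f (A u :: w)) A v)) f0 addr0.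
rewrite (sum_cuts_cons (fun u v => subst (fun w => f (A u :: w)) A v)) f0.
by rewrite !add0r subst_cons.
Qed.

(** Decomposition at the moment when the top frame is closed: [x.1] is what is
    read before that moment and [y.1] its part before the next comma or
    closing parenthesis, where a factor [acc] has already been collected. *)
Definition frame_eq a G args stk bs := forall acc,
  read_sum e0 e1 F acc ((a, G, args) :: stk) bs
  = \sum_(x <- cuts bs) \sum_(y <- cuts x.1)
      read_sum e0 e1 F
        (a * subst (fun w => G (args ++ acc * A y.1 :: w)) A y.2) stk x.2.

(** Given the decomposition, closing the frame now or continuing it combine into
    one substitution; this serves both for the block on top of the stack and
    for a block that begins. *)
Lemma read_sum_branch a G args stk bs :
  multilinear G -> stk_multilinear stk -> frame_eq a G args stk bs ->
  read_sum e0 e1 F (a * G args) stk bs + read_sum e0 e1 F 1 ((a, G, args) :: stk) bs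
  = \sum_(x <- cuts bs) read_sum e0 e1 F (a * subst (fun w => G (args ++ w)) A x.1) stk x.2.
Proof.
move=> Glin sl ->.
rewrite -(sum_cuts_left_nil (fun v => read_sum e0 e1 F (a * G args) stk v)) -big_split.
apply: eq_bigr => x _ /=; rewrite subst_cuts; last exact: multilinear_cat.
rewrite cats0; under eq_bigr do rewrite mul1r.
have lin := read_sum_linear x.2 sl.
rewrite mulrDr -[a * _ + _]/(a * _ + _) -[a * (if _ then _ else _)]scale1r lin scale1r.
rewrite mulr_sumr read_sum_bigsum //; congr (_ + _).
case: ifP => // _; rewrite mulr0.
have := read_sum_bigsum x.2 (nil : seq nat) (fun=> 0) sl.
by rewrite !big_nil.
Qed.

(** Induction on the number of letters to come.  In the equation of [A] at the
    first chunk, the term iota corresponds to a slot that continues or closes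
    the top block, and the other term to a slot that begins a nested block. *)
Lemma read_sum_frame a G args stk bs :
  multilinear G -> stk_multilinear stk -> frame_eq a G args stk bs.
Proof.
have A0 := words_nil AE.
have [n] := ubnP (size bs); elim: n bs a G args stk => // n IH bs a G args stk sn Glin sl acc.
(* The value once the current chunk of arguments is known to be [c]. *)
pose k c u v := read_sum e0 e1 F (a * subst (fun w => G (args ++ c :: w)) A u) stk v.
have ksum u v (I : Type) (r : seq I) (c : I -> B) :
    k (\sum_(i <- r) c i) u v = \sum_(i <- r) k (c i) u v.
  rewrite /k -read_sum_bigsum // -mulr_sumr /subst exchange_big.
  congr (read_sum _ _ _ (_ * _) _ _).
  by apply: eq_bigr => ps _; rewrite multilinear_bigsum.
have kD u v c c' : k (c + c') u v = k c u v + k c' u v.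
  have := ksum u v _ [:: c; c'] id; by rewrite !big_cons !big_nil !addr0.
have k0 u v : k 0 u v = 0.
  by have := ksum u v _ [::] id; rewrite !big_nil.
case: bs sn => [|b bs] /= sn.
  rewrite read_sum_nil (sum_cuts_nil (fun u v => \sum_(y <- cuts u) k (acc * A y.1) y.2 v)).
  rewrite (sum_cuts_nil (fun u v => k (acc * A u) v [::])).
  by rewrite A0 mulr0 k0.
rewrite (sum_cuts_cons (fun u v => \sum_(y <- cuts u) k (acc * A y.1) y.2 v)).
rewrite (sum_cuts_nil (fun u v => k (acc * A u) v _)) A0 mulr0 k0 add0r.
transitivity (\sum_(x <- cuts bs) \sum_(y <- cuts x.1) k (acc * A (b :: y.1)) y.2 x.2);
  last first.
  apply: eq_bigr => x _; rewrite (sum_cuts_cons (fun u v => k (acc * A u) v x.2)).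
  by rewrite A0 mulr0 k0 add0r.
(* [u] lies inside a block nested in the current chunk, [v] is the rest of that
   chunk, [w] the chunks after it and [t] what follows the closing. *)
pose q u v w t := k (acc * b * subst F A u * A v) w t.
have kA u v w : k (acc * A (b :: u)) v w = (if nilp u then k (acc * b) v w else 0)
    + if e1 then \sum_(t <- cuts u) q t.1 t.2 v w else 0.
  rewrite {1}AE /words_step conv_single_cons mulrDr kD; congr (_ + _).
    by case: u => [|c u] //=; rewrite mulr0 k0.
  case: {+}e1; last by rewrite mulr0 k0.
  rewrite mulrA /conv mulr_sumr ksum; apply: eq_bigr => t _.
  by rewrite /q mulrA.
under eq_bigr do under eq_bigr do rewrite kA.
under eq_bigr do rewrite big_split.
rewrite big_split /= read_sum_cons [LHS]addrC; congr (_ + _).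
  rewrite [LHS]addrC read_sum_branch //; last exact: IH.
  apply: eq_bigr => x _; rewrite (sum_cuts_left_nil (fun v => k (acc * b) v x.2)).
  rewrite /k; congr (read_sum _ _ _ (_ * _) _ _).
  by apply: eq_bigr => ps _; rewrite cat_rcons.
case: ifP => he; last by rewrite big1 // => x _; rewrite big1.
rewrite read_sum_branch //; last exact: IH.
transitivity (\sum_(x <- cuts bs) \sum_(z <- cuts x.2) \sum_(t <- cuts z.1) q x.1 t.1 t.2 z.2).
  apply: (eq_sum_cuts
    (h := fun u v => read_sum e0 e1 F (acc * b * subst F A u) ((a, G, args) :: stk) v)
    (g := fun u v => \sum_(z <- cuts v) \sum_(t <- cuts z.1) q u t.1 t.2 z.2)) => u v us vs.
  by apply: IH => //; lia.
rewrite -(sum_cuts_assoc (fun u v w => \sum_(t <- cuts v) q u t.1 t.2 w)).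
apply: eq_bigr => x _; by rewrite -(sum_cuts_assoc (fun u v w => q u v w x.2)).
Qed.

End Additivity.

(** At depth 0 the first outer block contributes a factor [subst F A], so the sum
    only depends on that series; this is what identifies R- and B-transforms
    in [read_sum_eq]. *)
Lemma read_sum_outer e1 F A acc b bs : multilinear F -> A = words_step e1 F A ->
  read_sum true e1 F acc [::] (b :: bs)
  = \sum_(x <- cuts bs) read_sum true e1 F (acc * b * subst F A x.1) [::] x.2.
Proof.
move=> Flin AE; rewrite read_sum_cons addr0 (read_sum_branch Flin AE) //.
exact: read_sum_frame.
Qed.

Lemma read_sum_eq e1 F A e1' F' A' acc bs :
  multilinear F -> A = words_step e1 F A ->
  multilinear F' -> A' = words_step e1' F' A' ->
  subst F A = subst F' A' ->
  read_sum true e1 F acc [::] bs = read_sum true e1' F' acc [::] bs.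
Proof.
move=> Flin AE F'lin A'E FF'.
have [n] := ubnP (size bs); elim: n bs acc => // n IH [|b bs] acc /= bn.
  by rewrite !read_sum_nil.
rewrite (read_sum_outer _ _ _ Flin AE) (read_sum_outer _ _ _ F'lin A'E) FF'.
apply: (eq_sum_cuts (h := fun u v => read_sum true e1 F (acc * b * subst F' A' u) [::] v)
  (g := fun u v => read_sum true e1' F' (acc * b * subst F' A' u) [::] v)) => u v us vs.
by apply: IH; lia.
Qed.

(** When nothing may follow the outer block, which is weighted by [G], only the
    cut with empty second part survives.  The two terms on the left are the
    cases of a singleton and of a larger outer block. *)
Lemma read_sum_irreducible F G A bs :
  multilinear F -> multilinear G -> A = words_step true F A ->
  read_sum false true F (G [::]) [::] bs + read_sum false true F 1 [:: (1, G, [::])] bs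
  = subst G A bs.
Proof.
move=> Flin Glin AE.
have fr : frame_eq false true F A 1 G [::] [::] bs by exact: read_sum_frame.
have := read_sum_branch Flin AE Glin _ fr => /(_ I).
rewrite mul1r => ->; rewrite -[RHS]sum_cuts_right_nil; apply: eq_bigr => -[u v] _ /=.
by case: v => [|b v]; rewrite ?read_sum_nil ?read_sum_cons ?mul1r ?addr0.
Qed.

End Reading.

(** * Balanced words and sequences of block minima *)

Section Labels.
Local Open Scope nat_scope.
Implicit Types (r st : seq nat) (w : seq slot) (m n : nat).

(** A partition is encoded by the sequence whose entry at a point is the minimum
    of the block of that point; these are the sequences with the following
    property. *)
Definition idempotent_labels r := forall i, i < size r ->
  nth 0 r i <= i /\ nth 0 r (nth 0 r i) = nth 0 r i.

(** Non-crossing in terms of block minima: if [j] lies between the minimum of a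
    block and its point [k], then the block of [j] does not begin earlier. *)
Definition nested_labels r := forall j k, j < k < size r ->
  nth 0 r k <= j -> nth 0 r k <= nth 0 r j.

Definition label_slot r m : slot := (nth 0 r m == m, nth 0 r m \notin drop m.+1 r).

Definition label_word r := [seq label_slot r i | i <- iota 0 (size r)].

Definition next_stack m st (x : slot) :=
  if x.1 then (if x.2 then st else m :: st) else if x.2 then behead st else st.

(** Reading a word from position [m] with the minima of the open blocks on the
    stack [st] recovers the sequence of minima. *)
Fixpoint word_labels m st w :=
  if w is x :: w' then
    (if x.1 then m else head 0 st) :: word_labels m.+1 (next_stack m st x) w'
  else [::].

Lemma size_word_labels m st w : size (word_labels m st w) = size w.
Proof. by elim: w m st => //= x w IH m st; rewrite IH. Qed.

Lemma size_next_stack m st x : size (next_stack m st x) = next_depth (size st) x.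
Proof. by rewrite /next_stack /next_depth; case: x => -[] [] //=; rewrite size_behead. Qed.

(** The minima of the blocks that are open just before [m], the latest first. *)
Definition open_labels r m :=
  [seq i <- rev (iota 0 m) | (nth 0 r i == i) && (i \in drop m r)].

Lemma open_labels_size r : open_labels r (size r) = [::].
Proof.
rewrite -[RHS](filter_pred0 (rev (iota 0 (size r)))).
by apply: eq_filter => i /=; rewrite drop_size in_nil andbF.
Qed.

(** Here non-crossing enters: a block that contains [m] and began
    before [m] must be on top of the stack. *)
Lemma open_labels_step r m : idempotent_labels r -> nested_labels r -> m < size r ->
  [/\ open_labels r m.+1 = next_stack m (open_labels r m) (label_slot r m),
      (if (label_slot r m).1 then m else head 0 (open_labels r m)) = nth 0 r m
    & ~~ (label_slot r m).1 -> open_labels r m != [::]].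
Proof.
move=> idr ncr mr; rewrite /next_stack /label_slot /=.
have dropE : drop m r = nth 0 r m :: drop m.+1 r by rewrite -drop_nth.
have oE : open_labels r m.+1 = if (nth 0 r m == m) && (m \in drop m.+1 r)
    then m :: [seq i <- rev (iota 0 m) | (nth 0 r i == i) && (i \in drop m.+1 r)]
    else [seq i <- rev (iota 0 m) | (nth 0 r i == i) && (i \in drop m.+1 r)].
  have iE : iota 0 m.+1 = rcons (iota 0 m) m by rewrite -cats1 -[m.+1]addn1 iotaD.
  by rewrite /open_labels iE rev_rcons.
have [rm _] := idr m mr; have [_ rrm] := idr m mr.
rewrite {}oE.
have [Em|Em] := eqVneq (nth 0 r m) m.
  have -> : [seq i <- rev (iota 0 m) | (nth 0 r i == i) && (i \in drop m.+1 r)]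
    = open_labels r m.
    apply: eq_in_filter => i; rewrite mem_rev mem_iota dropE inE Em => im.
    by case: eqP => //= _; case: (i =P m) => //; lia.
  by rewrite Em /=; split=> //; case: ifP; case: (m \in _).
have rlt : nth 0 r m < m by rewrite ltn_neqAle Em.
set t := nth 0 r m in rlt rrm Em dropE *.
(* Split the positions before [m] at [t], the minimum of the block of [m]:
   a block that began after [t] and is still open would cross that block. *)
have [o [openE oP]] : exists o, open_labels r m = t :: o /\
    [seq i <- rev (iota 0 m) | (nth 0 r i == i) && (i \in drop m.+1 r)]
    = if t \in drop m.+1 r then t :: o else o.
  have -> : iota 0 m = iota 0 t ++ t :: iota t.+1 (m - t.+1).
    have {1}-> : m = t + (m - t.+1).+1 by lia.
    by rewrite iotaD.
  rewrite /open_labels.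
  have -> : iota 0 m = iota 0 t ++ t :: iota t.+1 (m - t.+1).
    have {1}-> : m = t + (m - t.+1).+1 by lia.
    by rewrite iotaD.
  rewrite rev_cat rev_cons !filter_cat -cats1 !filter_cat.
  have none (s : seq nat) : {subset s <= drop m r} ->
      [seq i <- rev (iota t.+1 (m - t.+1)) | (nth 0 r i == i) && (i \in s)] = [::].
    move=> ss; apply/eqP; rewrite -(negbK (_ == _)) -has_filter; apply/hasPn => i.
    rewrite mem_rev mem_iota => it; apply/negP => /andP[/eqP ri /ss].
    rewrite dropE inE => /orP[/eqP|]; first by lia.
    move=> /(nthP 0)[j]; rewrite size_drop nth_drop => jr rj.
    have tj : m < m.+1 + j < size r by move: (jr : j < size r - m.+1); lia.
    have := ncr _ _ tj; rewrite rj -/t; lia.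
  rewrite !none // => [|i]; last by rewrite dropE inE orbC => ->.
  rewrite /= rrm eqxx dropE inE eqxx /=.
  exists [seq i <- rev (iota 0 t) | (nth 0 r i == i) && (i \in drop m r)].
  split; first by rewrite dropE.
  have -> : [seq i <- rev (iota 0 t) | (nth 0 r i == i) && (i \in drop m.+1 r)]
    = [seq i <- rev (iota 0 t) | (nth 0 r i == i) && (i \in drop m r)].
    apply: eq_in_filter => i; rewrite mem_rev mem_iota dropE inE => it.
    by case: (i =P t) => //; lia.
  by case: ifP.
rewrite openE oP; split=> //=.
by case: (t \in _).
Qed.

Lemma word_labels_drop r m : idempotent_labels r -> nested_labels r -> m <= size r ->
  let w := [seq label_slot r i | i <- iota m (size r - m)] in
  word_labels m (open_labels r m) w = drop m r
  /\ balanced true true (size (open_labels r m)) w.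
Proof.
move=> idr ncr; have [k] := ubnP (size r - m); elim: k m => // k IH m mk.
rewrite leq_eqVlt => /predU1P[->|mr].
  by rewrite subnn drop_size open_labels_size.
have [oE lE hdE] := open_labels_step idr ncr mr.
have -> : size r - m = (size r - m.+1).+1 by lia.
have mk' : size r - m.+1 < k by lia.
have [labE wfE] := IH m.+1 mk' mr.
rewrite [iota _ _]/= map_cons /= lE -oE labE -drop_nth //; split=> //.
rewrite -(size_next_stack m) -oE wfE andbT.
move: hdE; rewrite /label_slot /=; case: (_ == m) => /= [_|].
  by case: (size _).
by move=> /(_ isT); rewrite lt0n size_eq0.
Qed.

Lemma word_labels_slots r : idempotent_labels r -> nested_labels r ->
  word_labels 0 [::] (label_word r) = r /\ balanced true true 0 (label_word r).
Proof.
move=> idr ncr; have := word_labels_drop idr ncr (leq0n _).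
by rewrite subn0 drop0.
Qed.

Lemma nth_word_labels_gt m b st w a : m < a ->
  nth 0 (b :: word_labels m.+1 st w) (a - m) = nth 0 (word_labels m.+1 st w) (a - m.+1).
Proof. by move=> ma; rewrite -subnSK. Qed.

(** A label is inherited from the stack, or is the position of a slot read
    since. *)
Lemma word_labels_range m st w k : balanced true true (size st) w -> k < size w ->
  let r := word_labels m st w in
  (nth 0 r k \in st) \/
  (m <= nth 0 r k <= m + k /\ nth 0 r (nth 0 r k - m) = nth 0 r k).
Proof.
elim: w m st k => // x w IH m st k /= /andP[xP wP] kw.
case: k kw => [_|k kw] /=.
  case: ifP xP => [_ _|_]; first by right; rewrite subnn addn0 leqnn.
  by left; case: st wP xP => // t st _ _; rewrite inE eqxx.
rewrite -(size_next_stack m) in wP.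
have [inS|[mk lk]] := IH m.+1 _ k wP kw; last first.
  right; split; first lia.
  by rewrite nth_word_labels_gt //; lia.
move: inS wP xP; rewrite /next_stack; case: x => -[] [] /=; try by left.
- rewrite inE => /orP[/eqP E _ _|]; last by left.
  by right; rewrite E subnn; split=> //; lia.
- by case: st => // t st inS _ _; left; rewrite inE inS orbT.
Qed.

Lemma word_labels_stack m st w t : balanced true true (size st) w -> t \in st ->
  t \in word_labels m st w.
Proof.
elim: w m st => [|x w IH] m st /=; first by rewrite size_eq0 => /eqP->.
move=> /andP[xP]; rewrite -(size_next_stack m) => wP tst; rewrite inE.
have [tn|tn] := boolP (t \in next_stack m st x); first by rewrite IH ?orbT.
move: tn; rewrite /next_stack; case: x xP wP => -[] [] //= xP wP; rewrite ?tst //.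
  by rewrite inE tst orbT.
by case: st tst {xP wP} => //= t' st; rewrite inE => /orP[->//|->].
Qed.

Definition stack_below m st := sorted (fun i j => j < i) (m :: st).

Lemma stack_below_next m st x : stack_below m st -> stack_below m.+1 (next_stack m st x).
Proof.
rewrite /stack_below /next_stack; case: x => -[] [] /=.
- by case: st => //= t st /andP[tm ->]; rewrite andbT; lia.
- by move=> ->; rewrite ltnSn.
- by case: st => [|t [|t' st]] //= /and3P[tm tt' ->]; rewrite andbT; lia.
- by case: st => //= t st /andP[tm ->]; rewrite andbT; lia.
Qed.

Lemma stack_below_lt m st t : stack_below m st -> t \in st -> t < m.
Proof.
rewrite /stack_below /= => stP tst.
have tr : transitive (fun i j => j < i) by move=> a b c; lia.
by have /allP := order_path_min tr stP; apply.
Qed.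

Lemma word_labels_later m st w t : stack_below m st -> balanced true true (size st) w ->
  t < m -> (t \in word_labels m st w) = (t \in st).
Proof.
move=> stP wP tm; apply/idP/idP; last exact: word_labels_stack.
move=> /(nthP 0)[k]; rewrite size_word_labels => kw E.
by have := word_labels_range m wP kw; rewrite /= E => -[//|[]]; lia.
Qed.

Lemma word_labels_nested m st w : stack_below m st -> balanced true true (size st) w ->
  forall j k, j < k < size w ->
  let r := word_labels m st w in nth 0 r k <= m + j -> nth 0 r k <= nth 0 r j.
Proof.
elim: w m st => [|x w IH] m st stP /=; first by move=> _ j k; rewrite ltn0 andbF.
move=> /andP[xP]; rewrite -(size_next_stack m) => wP [|j] [|k] //= jk; last first.
  by rewrite -addSnnS; apply: IH => //; exact: stack_below_next.
rewrite addn0 => km.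
have : nth 0 (word_labels m.+1 (next_stack m st x) w) k \in next_stack m st x.
  rewrite -(word_labels_later (stack_below_next x stP) wP) ?ltnS //.
  by rewrite mem_nth // size_word_labels.
case: ifP xP => // x1 st0; rewrite /next_stack x1.
case: st stP {wP km} st0 => // t st stP _ kst.
have {stP} /andP[_ stP] : (t < m) && stack_below t st by [].
have : nth 0 (word_labels m.+1 (if x.2 then st else t :: st) w) k \in t :: st.
  by move: kst; case: x.2; rewrite //= inE orbC => ->.
by rewrite inE => /orP[/eqP->//|/(stack_below_lt stP)/ltnW].
Qed.

Lemma word_labels_slot m st w k : stack_below m st -> balanced true true (size st) w ->
  k < size w ->
  let r := word_labels m st w in
  (nth 0 r k == m + k, nth 0 r k \notin drop k.+1 r) = nth (true, true) w k.
Proof.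
elim: w m st k => // x w IH m st k stP /= /andP[xP].
rewrite -(size_next_stack m) => wP; have stP' := stack_below_next x stP.
case: k => [_|k kw] /=; last by rewrite addnS -addSn IH.
rewrite addn0 drop0 word_labels_later //; last first.
  case: (x.1); rewrite ?ltnSn //.
  case: st stP {xP wP stP'} => //= t st /andP[tm _]; exact: ltnW.
case: x xP {wP stP'} => -[] x2 /= => [_|st0].
  rewrite eqxx; congr (_, _); rewrite /next_stack /=.
  case: x2; last by rewrite inE eqxx.
  by apply/negP => /(stack_below_lt stP); rewrite ltnn.
case: st stP st0 => //= t st /andP[tm stP] _; rewrite ltn_eqF //; congr (_, _).
rewrite /next_stack /=; case: x2 => /=; last by rewrite inE eqxx.
by apply/negP => /(stack_below_lt stP); rewrite ltnn.
Qed.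

Lemma word_labels_idempotent w : balanced true true 0 w ->
  idempotent_labels (word_labels 0 [::] w).
Proof.
move=> wP k; rewrite size_word_labels => kw.
by have [|[]] := word_labels_range 0 (st := [::]) wP kw; rewrite ?in_nil // subn0.
Qed.

Lemma word_labels_nested0 w : balanced true true 0 w -> nested_labels (word_labels 0 [::] w).
Proof.
move=> wP j k; rewrite size_word_labels => jk.
exact: (@word_labels_nested 0 [::]).
Qed.

Lemma label_wordK w : balanced true true 0 w -> label_word (word_labels 0 [::] w) = w.
Proof.
move=> wP; apply: (@eq_from_nth _ (true, true)).
  by rewrite size_map size_iota size_word_labels.
move=> k; rewrite size_map size_iota size_word_labels => kw.
rewrite (nth_map 0) ?size_iota ?size_word_labels // nth_iota ?size_word_labels // add0n.
exact: (@word_labels_slot 0 [::]).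
Qed.

(** Blocks are intervals exactly when the minima never decrease along the points: a
    block that begins inside an open one is followed by a smaller minimum. *)
Lemma word_labels_sorted m st w : stack_below m st -> size st <= 1 ->
  balanced true true (size st) w ->
  sorted leq (word_labels m st w) = balanced true false (size st) w.
Proof.
elim: w m st => [|x w IH] m st stP st1 /=; first by rewrite size_eq0 => ->.
move=> /andP[xP]; rewrite -(size_next_stack m) => wP.
have stP' := stack_below_next x stP.
rewrite (path_sortedE leq_trans).
have allE a : a <= m -> (forall t, t \in next_stack m st x -> a <= t) ->
    all (leq a) (word_labels m.+1 (next_stack m st x) w).
  move=> am ast; apply/allP => t tr; case: (leqP t m) => [tm|]; last lia.
  by apply: ast; rewrite -(word_labels_later stP' wP).
case: x xP wP stP' allE => -[] x2 /= xP wP stP' allE.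
  case: st st1 stP xP wP stP' allE => [|t st] st1 stP xP wP stP' allE.
    rewrite allE //; last first.
      by move=> t; rewrite /next_stack /=; case: (x2); rewrite // inE => /eqP->.
    rewrite IH //.
    by rewrite /next_stack; case: (x2).
  apply/negbTE/negP => /andP[/allP h _].
  have tm : t < m by case/andP: stP.
  have /h : t \in word_labels m.+1 (next_stack m (t :: st) (true, x2)) w.
    by apply: word_labels_stack => //; rewrite /next_stack; case: (x2); rewrite !inE eqxx ?orbT.
  lia.
case: st st1 stP xP wP stP' allE => [|t [|t' st]] // _ stP xP wP stP' allE.
have tm : t < m by case/andP: stP.
rewrite allE; [|exact: ltnW|]; last first.
  by move=> t'; rewrite /next_stack /=; case: (x2); rewrite //= inE => /eqP->.
rewrite IH //.
by rewrite /next_stack; case: (x2).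
Qed.

(** The bottom block of the stack, with minimum [z], contains the last point
    exactly when nothing follows its closing.  The hypothesis [last z st = z]
    also covers the empty stack, when that block is already closed. *)
Lemma word_labels_last m st w z : stack_below m st -> z < m -> last z st = z ->
  balanced true true (size st) w ->
  (last z (word_labels m st w) == z) = balanced false true (size st) w.
Proof.
elim: w m st => [|x w IH] m st stP zm stz /=; first by rewrite eqxx => ->.
move=> /andP[xP]; rewrite -(size_next_stack m) => wP.
have stP' := stack_below_next x stP.
have lastE a : w != [::] -> last a (word_labels m.+1 (next_stack m st x) w)
    = last z (word_labels m.+1 (next_stack m st x) w) by case: (w).
case: st stP stz xP wP stP' lastE => [|t st] stP stz xP wP stP' lastE.
  rewrite [RHS](_ : _ = false); last by case: (x.1).
  have x1 : x.1 by case: (x.1) xP.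
  apply/negP => /eqP; rewrite x1; set r := word_labels _ _ _ => rz.
  have : z \in m :: r by rewrite -{1}rz mem_last.
  rewrite inE => /orP[|]; first lia.
  rewrite word_labels_later //; last lia.
  rewrite /next_stack x1; case: x.2; rewrite // inE; lia.
have [w0|w0] := eqVneq w [::].
  move: wP xP stz; rewrite w0 /= /next_stack; case: (x) => -[] [] //= .
  by case: (st) => //= _ _ ->; rewrite eqxx.
rewrite lastE // IH //; last first.
- by rewrite /next_stack; case: (x) stz => -[] [] //=; case: (st).
- lia.
by rewrite (_ : (if x.1 then _ else _) = true) //; case: (x.1).
Qed.

Lemma word_labels_first x w : balanced true true 0 (x :: w) ->
  (last 0 (word_labels 0 [::] (x :: w)) == 0)
  = balanced false true (next_depth 0 x) w.
Proof.
move=> /= /andP[xP wP]; rewrite -(size_next_stack 0 [::]).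
case: x xP wP => -[] x2 //= _ wP.
by apply: word_labels_last; rewrite ?size_next_stack //; case: (x2).
Qed.

End Labels.

(** * Non-crossing partitions as balanced words *)

Section Partitions.
Local Open Scope nat_scope.
Variable n : nat.
Implicit Types (p : {set {set 'I_n}}) (i j k : 'I_n).

Definition block_min p i : 'I_n := [arg min_(j < i in pblock p i) (j : nat)].

Definition labels p : seq nat := [seq nat_of_ord (block_min p i) | i <- enum 'I_n].

Definition partition_word p : seq slot :=
  [seq (is_min (pblock p i) i, is_max (pblock p i) i) | i <- enum 'I_n].

Lemma size_labels p : size (labels p) = n.
Proof. by rewrite size_map size_enum_ord. Qed.

Lemma nth_labels p i : nth 0 (labels p) i = block_min p i.
Proof. by rewrite (nth_map i) ?size_enum_ord // nth_ord_enum. Qed.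

Lemma last_labels p i : (i : nat).+1 = n -> last 0 (labels p) = block_min p i.
Proof. by move=> iN; rewrite -nth_labels -nth_last size_labels; congr nth; rewrite -[in LHS]iN. Qed.

Section OnePartition.
Variable p : {set {set 'I_n}}.
Hypothesis pP : partition p [set: 'I_n].

Let mem_pblockT i : i \in pblock p i.
Proof. by rewrite mem_pblock (cover_partition pP) inE. Qed.

Let pblock_eq i j : (j \in pblock p i) = (pblock p i == pblock p j).
Proof. by rewrite eq_pblock ?(cover_partition pP) ?inE //; case/and3P: pP. Qed.

Lemma block_minP i : block_min p i \in pblock p i /\
  forall j, j \in pblock p i -> block_min p i <= j.
Proof. by rewrite /block_min; case: arg_minnP. Qed.

Lemma block_min_eq i j : (block_min p i == block_min p j) = (j \in pblock p i).
Proof.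
apply/eqP/idP => [ij|].
  have [+ _] := block_minP i; have [+ _] := block_minP j.
  by rewrite ij !pblock_eq => /eqP-> /eqP->.
rewrite pblock_eq => /eqP ij; apply: val_inj; apply/eqP; rewrite eqn_leq.
have [hi hi'] := block_minP i; have [hj hj'] := block_minP j.
by rewrite hi' ?hj' ?ij // -ij.
Qed.

Lemma labels_idempotent : idempotent_labels (labels p).
Proof.
move=> i; rewrite size_labels => ilt; rewrite -[ i ]/(val (Ordinal ilt)) nth_labels.
have [h1 h2] := block_minP (Ordinal ilt); split; first exact: h2.
by rewrite nth_labels; apply/eqP; rewrite eq_sym val_eqE block_min_eq.
Qed.

Lemma label_word_labels : label_word (labels p) = partition_word p.
Proof.
apply: (@eq_from_nth _ (true, true)).
  by rewrite size_map size_iota size_labels [RHS]size_map size_enum_ord.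
move=> i; rewrite size_map size_iota size_labels => ilt.
rewrite (nth_map 0) ?size_iota ?size_labels // nth_iota ?size_labels // add0n.
rewrite (nth_map (Ordinal ilt)) ?size_enum_ord // -[X in nth _ _ X]/(val (Ordinal ilt)).
rewrite nth_ord_enum -[ i ]/(val (Ordinal ilt)); move: (Ordinal ilt) => {ilt}i.
rewrite /label_slot nth_labels; have [h1 h2] := block_minP i; congr (_, _).
  apply/eqP/forall_inP => [im j /h2|imin]; first by rewrite im.
  by apply/eqP; rewrite eqn_leq h2 ?imin.
apply/idP/forall_inP => [im j jp|imax].
  rewrite leqNgt; apply: contra im => ij.
  apply/(nthP 0); exists (j - i.+1).
    by rewrite size_drop size_labels ltn_sub2r // (leq_ltn_trans _ (ltn_ord j)).
  rewrite nth_drop subnKC // nth_labels; apply/eqP.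
  by rewrite val_eqE eq_sym block_min_eq.
apply/(nthP 0) => -[j]; rewrite size_drop size_labels nth_drop => jlt.
have jn : i.+1 + j < n by move: (jlt : j < n - i.+1); lia.
rewrite -[_ + j]/(val (Ordinal jn)) nth_labels => /eqP.
rewrite val_eqE eq_sym block_min_eq => /imax /=; lia.
Qed.

Lemma labels_nested : reflect (nested_labels (labels p)) (p \in NC n).
Proof.
rewrite inE /noncrossing pP /=; apply: (iffP idP) => [nc|nc].
  move=> j k; rewrite size_labels => /andP[jk kn].
  have jn : j < n by lia.
  move: jk; rewrite -[k]/(val (Ordinal kn)) -[j]/(val (Ordinal jn)) !nth_labels.
  move: (Ordinal kn) (Ordinal jn) => {kn jn}k {}j /= jk kj.
  rewrite leqNgt; apply/negP => jk'.
  have [hk hk'] := block_minP k; have [hj hj'] := block_minP j.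
  have kj' : block_min p k < j.
    rewrite ltn_neqAle kj andbT; apply/eqP => /val_inj E; move: hk jk'.
    by rewrite -block_min_eq E => /eqP<-; rewrite ltnn.
  have pbV i : pblock p i \in p by rewrite pblock_mem // (cover_partition pP) inE.
  move/forall_inP: nc => /(_ _ (pbV j)) /forall_inP /(_ _ (pbV k)).
  move=> /forall_inP /(_ _ hj) /forall_inP /(_ _ hk) /forall_inP /(_ _ (mem_pblockT j)).
  move=> /forall_inP /(_ _ (mem_pblockT k)); rewrite jk' kj' jk /= => /eqP E.
  have /eqP : block_min p j == block_min p k by rewrite block_min_eq E.
  by move=> E'; rewrite E' ltnn in jk'.
apply/forall_inP => V Vp; apply/forall_inP => W Wp; apply/forall_inP => i iV.
apply/forall_inP => j jW; apply/forall_inP => k kV; apply/forall_inP => l lW.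
apply/implyP => /andP[/andP[ij jk] kl].
have trivp : trivIset p by case/and3P: pP.
have Vi := def_pblock trivp Vp iV; have Vk := def_pblock trivp Vp kV.
have Wj := def_pblock trivp Wp jW; have Wl := def_pblock trivp Wp lW.
have ik : block_min p i = block_min p k by apply/eqP; rewrite block_min_eq Vi.
have jl : block_min p j = block_min p l by apply/eqP; rewrite block_min_eq Wj.
have := nc j k; have := nc k l; rewrite size_labels !nth_labels -jl -ik jk kl !ltn_ord.
move=> /(_ isT) h1 /(_ isT) h2.
have [_ hi] := block_minP i; have [_ hj] := block_minP j.
have := hi i (mem_pblockT i); have := hj j (mem_pblockT j) => hj' hi'.
have E : block_min p i = block_min p j by apply: val_inj => /=; lia.
by rewrite -Vi -Wj -pblock_eq -block_min_eq E.
Qed.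

Lemma labels_sorted : sorted leq (labels p) = (p \in IntP n).
Proof.
rewrite inE pP /=; apply/idP/forall_inP => [srt V Vp|int].
  apply/forall_inP => i iV; apply/forall_inP => k kV; apply/forallP => j.
  apply/implyP => /andP[ij jk].
  have trivp : trivIset p by case/and3P: pP.
  have Vi := def_pblock trivp Vp iV.
  have ik : block_min p i = block_min p k by apply/eqP; rewrite block_min_eq Vi.
  have mono (a b : 'I_n) : a <= b -> block_min p a <= block_min p b.
    move=> ab; rewrite -!nth_labels.
    by apply: (sorted_leq_nth leq_trans leqnn 0 srt); rewrite ?inE ?size_labels.
  rewrite -Vi -block_min_eq; apply/eqP/val_inj => /=.
  have := mono _ _ (ltnW ij); have := mono _ _ (ltnW jk); rewrite -ik; lia.
apply/(sortedP 0) => i; rewrite size_labels => i1n; have i0n := ltnW i1n.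
rewrite -[i.+1]/(val (Ordinal i1n)) -[ i ]/(val (Ordinal i0n)) !nth_labels.
have [h1 _] := block_minP (Ordinal i1n); have [h2 h2'] := block_minP (Ordinal i0n).
rewrite leqNgt; apply/negP => lt.
have pbV : pblock p (Ordinal i1n) \in p by rewrite pblock_mem // (cover_partition pP) inE.
move/forall_inP: (int _ pbV) => /(_ _ h1) /forall_inP /(_ _ (mem_pblockT _)).
move=> /forallP /(_ (Ordinal i0n)); rewrite /= ltnSn andbT.
rewrite (leq_trans lt) /=; last exact: (h2' _ (mem_pblockT _)).
by rewrite -block_min_eq => /eqP E; rewrite E ltnn in lt.
Qed.

End OnePartition.

Lemma labels_inj p q : partition p [set: 'I_n] -> partition q [set: 'I_n] ->
  labels p = labels q -> p = q.
Proof.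
move=> pP qP pq; rewrite -(equivalence_partition_pblock pP) -(equivalence_partition_pblock qP).
have E i j : (j \in pblock p i) = (j \in pblock q i).
  by rewrite -!block_min_eq // -!val_eqE /= -!nth_labels pq.
by apply: eq_imset => i; apply/setP => j; rewrite !inE E.
Qed.

Lemma labels_surj (r : seq nat) : size r = n -> idempotent_labels r ->
  exists2 p, partition p [set: 'I_n] & labels p = r.
Proof.
move=> rn idr; pose f i := nth 0 r (i : 'I_n).
(* The blocks are the fibres of the labelling; the labels are their minima because
   the labels are idempotent and bounded by their positions. *)
pose R : rel 'I_n := fun i j => f i == f j.
have Req : {in [set: 'I_n] & &, equivalence_rel R}.
  by move=> i j k _ _ _; split; rewrite /R // => /eqP->.
have pP := equivalence_partitionP Req.
exists (equivalence_partition R [set: 'I_n]) => //.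
have pbE i j : (j \in pblock (equivalence_partition R [set: 'I_n]) i) = R i j.
  by rewrite pblock_equivalence_partition ?inE.
apply: (@eq_from_nth _ 0); rewrite size_labels ?rn // => i ilt.
rewrite -[ i ]/(val (Ordinal ilt)) nth_labels.
have [h1 h2] := block_minP pP (Ordinal ilt).
have ir : i < size r by rewrite rn.
have [ri rri] := idr i ir.
have rin : nth 0 r i < n by rewrite (leq_ltn_trans ri).
apply/eqP; rewrite eqn_leq.
have /h2 -> : Ordinal rin \in pblock (equivalence_partition R [set: 'I_n]) (Ordinal ilt).
  by rewrite pbE /R /f /= rri.
move: h1; rewrite pbE /R /f /= => /eqP ->.
have mr : block_min (equivalence_partition R [set: 'I_n]) (Ordinal ilt) < size r.
  by rewrite rn.
by have [] := idr _ mr.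
Qed.

End Partitions.

Section WordBijection.
Local Open Scope nat_scope.

Lemma slot_words_mem n w : (w \in slot_words n) = (size w == n).
Proof.
elim: n w => [|n IH] [|x w] //.
  by apply/negbTE/negP => /allpairsP[[y v] [_ _]].
rewrite eqSS -IH; apply/allpairsP/idP => [[[y v] [_ /= vn [_ ->]]]//|wn].
by exists (x, w); split=> //; case: x => -[] [].
Qed.

Lemma slot_words_uniq n : uniq (slot_words n).
Proof.
elim: n => // n IH; apply: allpairs_uniq => //.
by move=> [x w] [y v] _ _ /= [-> ->].
Qed.

Lemma partition_word_NC n (p : {set {set 'I_n}}) : p \in NC n ->
  word_labels 0 [::] (partition_word p) = labels p /\ balanced true true 0 (partition_word p).
Proof.
move=> pNC; have pP : partition p [set: 'I_n] by move: pNC; rewrite inE => /andP[].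
rewrite -label_word_labels //; apply: word_labels_slots; first exact: labels_idempotent.
exact/labels_nested.
Qed.

(** The bijection between non-crossing partitions and balanced words.  It is
    injective because reading the word recovers the minima of the blocks, and
    onto because the minima read from a balanced word define a partition. *)
Lemma perm_partition_words n :
  perm_eq [seq partition_word p | p <- enum (NC n)]
    [seq w <- slot_words n | balanced true true 0 w].
Proof.
have NCp (p : {set {set 'I_n}}) : p \in NC n -> partition p [set: 'I_n].
  by rewrite inE => /andP[].
apply: uniq_perm.
- rewrite map_inj_in_uniq ?enum_uniq // => p q; rewrite !mem_enum => pN qN pq.
  apply: labels_inj; rewrite ?NCp //.
  have [<- _] := partition_word_NC pN; have [<- _] := partition_word_NC qN.
  by rewrite pq.
- by rewrite filter_uniq ?slot_words_uniq.
move=> w; rewrite mem_filter slot_words_mem; apply/mapP/andP => [[p]|[wP /eqP wn]].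
  rewrite mem_enum => pN ->; have [_ ->] := partition_word_NC pN.
  by rewrite size_map size_enum_ord.
have [||p pP pE] := @labels_surj n (word_labels 0 [::] w).
- by rewrite size_word_labels.
- exact: word_labels_idempotent.
exists p.
  by rewrite mem_enum; apply/(labels_nested pP); rewrite pE; exact: word_labels_nested0.
by rewrite -label_word_labels // pE label_wordK.
Qed.

Lemma sum_NC (V : nmodType) n (P : pred {set {set 'I_n}})
    (P' : pred (seq slot)) (f : seq slot -> V) :
  {in NC n, forall p, P p = P' (partition_word p)} ->
  (\sum_(p in NC n | P p) f (partition_word p)
  = \sum_(w <- slot_words n | balanced true true 0 w && P' w) f w)%R.
Proof.
move=> PP'; rewrite -[RHS]big_filter_cond -(perm_big _ (perm_partition_words n)) big_map.
rewrite big_enum_cond; apply: eq_bigl => p.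
by apply: andb_id2l => /PP'.
Qed.

Lemma balanced_weak e0 e1 d w : balanced e0 e1 d w -> balanced true true d w.
Proof.
elim: w d => //= x w IH d /andP[xd /IH->]; rewrite andbT.
by case: (x.1) xd => //; case: d.
Qed.

Lemma Int_word n (p : {set {set 'I_n}}) : p \in NC n ->
  (p \in IntP n) = balanced true false 0 (partition_word p).
Proof.
move=> pN; have [lE wP] := partition_word_NC pN.
have pP : partition p [set: 'I_n] by move: pN; rewrite inE => /andP[].
by rewrite -labels_sorted // -lE (@word_labels_sorted 0 [::]).
Qed.

Lemma Int_NC n (p : {set {set 'I_n}}) : p \in IntP n -> p \in NC n.
Proof.
move=> pI; have pP : partition p [set: 'I_n] by move: pI; rewrite inE => /andP[].
apply/(labels_nested pP) => j k /andP[jk kn].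
have srt : sorted leq (labels p) by rewrite labels_sorted.
move=> rkj; have [_ <-] := labels_idempotent pP kn.
apply: (sorted_leq_nth leq_trans leqnn 0 srt) => //.
- exact: leq_ltn_trans rkj (ltn_trans jk kn).
- exact: ltn_trans jk kn.
Qed.

Lemma sum_Int (V : nmodType) n (f : seq slot -> V) :
  (\sum_(p in IntP n) f (partition_word p)
  = \sum_(w <- slot_words n | balanced true false 0 w) f w)%R.
Proof.
(* Interval partitions are non-crossing, so their words are the balanced words
   that satisfy the stronger condition. *)
transitivity (\sum_(p in NC n | p \in IntP n) f (partition_word p))%R.
  by apply: eq_bigl => p; case: (boolP (p \in IntP n)) => [/Int_NC->|]; rewrite ?andbF.
rewrite (sum_NC (P' := balanced true false 0)) => [|p]; last exact: Int_word.
by apply: eq_bigl => w; apply/andb_idl/balanced_weak.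
Qed.

Definition irreducible_word (w : seq slot) : bool :=
  if w is x :: w' then balanced false true (next_depth 0 x) w' else false.

Lemma ll1_word n (p : {set {set 'I_n.+1}}) : p \in NC n.+1 ->
  ll1 p = irreducible_word (partition_word p).
Proof.
move=> pN; have [lE wP] := partition_word_NC pN.
have pP : partition p [set: 'I_n.+1] by move: pN; rewrite inE => /andP[].
have -> : ll1 p = (last 0 (labels p) == 0).
  rewrite /ll1 /outer_block -block_min_eq //.
  have b0 : (block_min p ord0 : nat) = 0.
    have [_ h] := block_minP pP ord0; apply/eqP; rewrite -leqn0; apply: (h ord0).
    by rewrite mem_pblock (cover_partition pP) inE.
  by rewrite -val_eqE /= b0 (last_labels p (i := ord_max)) // eq_sym.
rewrite -lE; case E: (partition_word p) wP => [|x w] wP.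
  by move: (congr1 size E); rewrite size_map size_enum_ord.
by rewrite word_labels_first.
Qed.

End WordBijection.

Section Strings.
Variables (K : comNzRingType) (B : algType K).
Local Open Scope ring_scope.

Lemma letter_slot n (H : {set 'I_n} -> seq B -> B) (p : {set {set 'I_n}}) m :
  partition p [set: 'I_n] ->
  letter H p m = slot_token (H (pblock p m)) (is_min (pblock p m) m, is_max (pblock p m) m).
Proof.
move=> pP; have mV : m \in pblock p m by rewrite mem_pblock (cover_partition pP) inE.
rewrite /letter /slot_token /=.
have -> : (#|pblock p m| == 1%N) = is_min (pblock p m) m && is_max (pblock p m) m.
  apply/cards1P/andP => [[i Vi]|[/forall_inP mmin /forall_inP mmax]].
    move: mV; rewrite Vi inE => /eqP->.
    by split; apply/forall_inP => j; rewrite inE => /eqP->.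
  exists m; apply/setP => i; rewrite inE; apply/idP/eqP => [iV|-> //].
  by apply/val_inj/eqP; rewrite eqn_leq mmin ?mmax.
by case: is_min; case: is_max.
Qed.

Lemma weave_enum n (G : seq B -> B) (f : 'I_n -> slot) (s : seq B) : size s = n ->
  weave G s [seq f i | i <- enum 'I_n]
  = flatten [seq [:: Coef (nth 0 s i); slot_token G (f i)] | i : 'I_n <- enum 'I_n].
Proof.
elim: s n f => [|b s IH] [|n] f // => [_|[sn]].
  by rewrite (size0nil (size_enum_ord 0)).
rewrite enum_ordSl !map_cons -!(map_comp _ (lift ord0)).
transitivity [:: Coef b, slot_token G (f ord0)
    & weave G s [seq (f \o lift ord0) i | i <- enum 'I_n]]; first by [].
rewrite IH //; congr [:: _, _ & flatten _].
Qed.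

(** The outer series [F] only weighs the block of the first point. *)
Definition read_word (F G : seq B -> B) (s : seq B) (w : seq slot) : B :=
  if w is x :: w' then read 1 [::] (slot_token F x :: weave G s w') else 0.

(** The weight of a block only enters the string at its minimum; a minimum other
    than the first point cannot lie in the block of the first point. *)
Lemma nested_word (F G : seq B -> B) (s : seq B) n (H : {set 'I_n.+1} -> seq B -> B)
    (p : {set {set 'I_n.+1}}) : size s = n -> partition p [set: 'I_n.+1] ->
  H (pblock p ord0) = F ->
  (forall V, V != pblock p ord0 -> H V = G) ->
  nested H p s = read_word F G s (partition_word p).
Proof.
move=> sn pP HF HG; rewrite /nested /string /partition_word enum_ordSl /=.
rewrite letter_slot // HF -map_comp weave_enum //; congr (@read K B _ _ (_ :: flatten _)).
apply: eq_map => i; rewrite letter_slot //; congr [:: _; _].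
rewrite /slot_token /=; case: ifP => // imin; rewrite HG //.
apply: contraTneq imin => ->; apply/forall_inPn; exists ord0 => //.
by rewrite mem_pblock (cover_partition pP) inE.
Qed.

Lemma mono_nested_word (F : seq B -> B) (s : seq B) n (p : {set {set 'I_n.+1}}) :
  size s = n -> partition p [set: 'I_n.+1] ->
  mono_nested F p s = read 1 [::] (weave F (1 :: s) (partition_word p)).
Proof.
move=> sn pP; rewrite /mono_nested (@nested_word F F) // /partition_word enum_ordSl /=.
by rewrite mul1r.
Qed.

Lemma sum_NC_read (F : seq B -> B) (s : seq B) :
  \sum_(p in NC (size s).+1) mono_nested F p s = read_sum true true F 1 [::] (1 :: s).
Proof.
pose f w := read 1 [::] (weave F (1 :: s) w).
transitivity (\sum_(p in NC (size s).+1 | true) f (partition_word p)).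
  apply: eq_big => [p|p]; first by rewrite andbT.
  rewrite inE => /andP[pP _].
  exact: mono_nested_word.
rewrite (sum_NC (P' := xpredT)) //.
by apply: eq_bigl => w; rewrite andbT.
Qed.

Lemma sum_Int_read (F : seq B -> B) (s : seq B) :
  \sum_(p in IntP (size s).+1) mono_nested F p s = read_sum true false F 1 [::] (1 :: s).
Proof.
pose f w := read 1 [::] (weave F (1 :: s) w).
rewrite [RHS](_ : _ = \sum_(w <- slot_words (size s).+1 | balanced true false 0 w) f w) //.
rewrite -sum_Int; apply: eq_bigr => p; rewrite inE => /andP[pP _].
exact: mono_nested_word.
Qed.

Lemma sum_ll1_read (F G : seq B -> B) (s : seq B) :
  \sum_(p in NC (size s).+1 | ll1 p) coloured_nested F G p (outer_colouring p) s
  = read_sum false true G (F [::]) [::] s + read_sum false true G 1 [:: (1, F, [::])] s.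
Proof.
transitivity (\sum_(p in NC (size s).+1 | ll1 p) read_word F G s (partition_word p)).
  apply: eq_bigr => p /andP[]; rewrite inE => /andP[pP _] _.
  apply: nested_word => // [|V Vp]; rewrite /outer_colouring /outer_block.
    by rewrite eqxx.
  by rewrite (negbTE Vp).
rewrite (sum_NC (P' := irreducible_word)) => [|p]; last exact: ll1_word.
rewrite /read_sum /= cats0 !big_cat !big_map /= !big_pred0_eq !addr0 !mul1r.
by congr (_ + _); apply: eq_bigl => w; apply/andb_idl/balanced_weak.
Qed.

End Strings.

(** * Transforms as substitutions *)

Section Transforms.
Variables (K : comNzRingType) (B : algType K).
Implicit Types (mu : distr B) (F : series B) (alpha : {linear B -> B}).

Lemma words_exists e (f : seq B -> B) : exists A, A = words_step e f A.
Proof. exact: contract_exists (words_step_contract _ _). Qed.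

(** Multilinearity is what kills the terms with a chunk longer than one letter,
    where iota vanishes. *)
Lemma subst_singler (f : seq B -> B) : multilinear f -> subst f (@single K B) = f.
Proof.
move=> flin; apply: funext => s; have [n] := ubnP (size s).
elim: n s f flin => // n IH [|b s] f flin /= sn; first exact: subst_nil.
rewrite subst_cons -[RHS](sum_cuts_left_nil (fun v => f (b :: v))).
apply: (eq_sum_cuts (h := fun u v => subst (fun w => f (single (b :: u) :: w)) (@single K B) v)
  (g := fun u v => if nilp u then f (b :: v) else 0)) => -[|c u] v _ vs /=.
  by apply: (IH v (fun w => f (b :: w))); [exact: (@multilinear_cat _ _ [:: b] f)|lia].
by rewrite /subst big1 // => ps _; exact: (multilinear0 flin [::]).
Qed.

Lemma RBhat_subst alpha F A : A = words_step true (alpha \o F) A ->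
  RBhat alpha F = subst F A :> (seq B -> B).
Proof.
move=> AE; apply: funext => s; rewrite -[LHS]/(RBhat_fun alpha F s) /RBhat_fun sum_ll1_read.
apply: read_sum_irreducible => //; exact: sfun_multilinear.
Qed.

(** Sums over NC with weights F and over Int with weights B have the same
    decomposition into outer blocks as soon as F o A_F = B o iota = B. *)
Lemma Btransform_RBhat mu : Btransform mu = RBhat idfun (Rtransform mu).
Proof.
set F := Rtransform mu; have Flin := sfun_multilinear F.
have [A AE] := words_exists true F.
apply: Btransform_eq => s; rewrite (RtransformP mu s) sum_NC_read sum_Int_read.
have singleE f : @single K B = words_step false f (@single K B).
  by apply: funext => t; rewrite /words_step addr0.
apply: (read_sum_eq _ _ Flin AE (sfun_multilinear _) (singleE _)).
by rewrite (subst_singler (sfun_multilinear _)) (RBhat_subst (A := A)).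
Qed.

(** The semigroup law, read for cumulants. *)
Lemma RBhat_dilation alpha F :
  RBhat idfun (comp_series (idfun \+ alpha) F)
  = comp_series (idfun \+ alpha) (RBhat idfun (RBhat alpha F)).
Proof.
have Flin := sfun_multilinear F.
have [P PE] := words_exists true (alpha \o F).
have [Q QE] := words_exists true (subst F P).
have [W WE] := words_exists true (F \+ (alpha \o F)).
have GE := RBhat_subst PE.
apply: seriesP => s; rewrite (RBhat_subst (A := W)) //.
rewrite -[RHS]/((idfun \+ alpha) (RBhat idfun (RBhat alpha F) s)).
rewrite (RBhat_subst (A := Q)) ?GE // subst_assoc //.
rewrite (words_semigroup Flin (comp_series_subproof alpha F) PE QE WE).
exact: (congr1 (@^~ s) (subst_additive (idfun \+ alpha) F W)).
Qed.

Lemma Btransform_BBmap mu alpha :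
  comp_series (idfun \+ alpha) (Btransform (BBmap alpha mu))
  = Btransform (boxplus_pow mu (idfun \+ alpha)).
Proof.
by rewrite !Btransform_RBhat /BBmap /boxplus_pow !Rtransform_invK RBhat_dilation.
Qed.

Lemma Btransform_K : cancel (@Btransform K B) (@Btransform_inv K B).
Proof.
move=> mu; have [nu [_ uniq_nu]] := Btransform_bij (Btransform mu).
by transitivity nu; [symmetry|]; apply: uniq_nu; rewrite ?Btransform_invK.
Qed.

End Transforms.

Theorem proposition6p6 (R : realType) (B : cstarAlgType R) :
  (forall (mu : distr B) (alpha : {linear B -> B}),
      uplus_pow (BBmap alpha mu) (idfun \+ alpha)
      = boxplus_pow mu (idfun \+ alpha))
  /\
  (forall alpha beta : {linear B -> B},
      cancel (idfun \+ alpha) beta -> cancel beta (idfun \+ alpha) ->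
      forall mu : distr B,
        BBmap alpha mu = uplus_pow (boxplus_pow mu (idfun \+ alpha)) beta).
Proof.
split=> [mu alpha|alpha beta alphaK _ mu]; rewrite /uplus_pow.
  by rewrite Btransform_BBmap Btransform_K.
rewrite -Btransform_BBmap -[LHS]Btransform_K; congr Btransform_inv.
by apply: seriesP => s; rewrite /= -[RHS]/(beta ((idfun \+ alpha) _)) alphaK.
Qed.
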